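(* Two forests $F_1$ and $F_2$ are isomorphic as graphs if and only if their isotropic matroids $M[IAS(F_1)]$ and $M[IAS(F_2)]$ are isomorphic as matroids.
   Context: A forest is a finite simple graph (no loops, no multiple edges) without cycles. For a finite graph $G$ without multiple edges (and with at most one loop per vertex), $A(G)$ is the $V(G)\times V(G)$ adjacency matrix over $GF(2)$ (diagonal entry $1$ exactly at looped vertices, off-diagonal entry $1$ exactly for adjacent distinct vertices). $IAS(G)$ is the $GF(2)$-matrix $(I\mid A(G)\mid A(G)+I)$ with rows indexed by $V(G)$; for $v\in V(G)$ the $v$-columns of the three blocks are labelled $\phi_G(v),\chi_G(v),\psi_G(v)$. The isotropic matroid $M[IAS(G)]$ is the binary column matroid of $IAS(G)$, with ground set $W(G)=\{\phi_G(v),\chi_G(v),\psi_G(v): v\in V(G)\}$. *)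

(* Defs.v *)
From HB Require Import structures.
From mathcomp Require Import all_boot all_order all_algebra.
Set Implicit Arguments. Unset Strict Implicit. Unset Printing Implicit Defensive.
Import GRing.Theory.
Local Open Scope ring_scope.

Definition simple_graph (V : finType) (e : rel V) : Prop :=
  symmetric e /\ irreflexive e.

Definition acyclic (V : finType) (e : rel V) : Prop :=
  forall c : seq V, (2 < size c)%N -> uniq c -> ~~ cycle e c.

Definition forest (V : finType) (e : rel V) : Prop :=
  simple_graph e /\ acyclic e.

Definition graph_iso (V1 V2 : finType) (e1 : rel V1) (e2 : rel V2) : Prop :=
  exists f : V1 -> V2, bijective f /\ forall x y, e2 (f x) (f y) = e1 x y.

Definition adjF2 (V : finType) (e : rel V) (u v : V) : 'F_2 := (e u v)%:R.

(* Ground set W(G): (v, 0) = phi_G(v), (v, 1) = chi_G(v), (v, 2) = psi_G(v). *)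
Definition Wg (V : finType) := (V * 'I_3)%type.

(* The column of IAS(G) = (I | A(G) | A(G)+I) labelled by w, as a vector
   indexed by V (row index u). *)
Definition IAS_col (V : finType) (e : rel V) (w : Wg V) (u : V) : 'F_2 :=
  let: (v, k) := w in
  match val k with
  | 0 => (u == v)%:R
  | 1 => adjF2 e u v
  | _ => adjF2 e u v + (u == v)%:R
  end.

Definition iso_indep (V : finType) (e : rel V) (S : {set Wg V}) : Prop :=
  forall c : Wg V -> 'F_2,
    (forall w, w \notin S -> c w = 0) ->
    (forall u : V, \sum_(w : Wg V) c w * IAS_col e w u = 0) ->
    forall w, c w = 0.

Definition isotropic_matroid_iso (V1 V2 : finType) (e1 : rel V1) (e2 : rel V2)
  : Prop :=
  exists g : Wg V1 -> Wg V2, bijective g /\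
    forall S : {set Wg V1}, iso_indep e1 S <-> iso_indep e2 (g @: S).

(* Main.v *)
Require Import Defs.
From mathcomp Require Import all_boot all_order all_algebra zify.
Set Implicit Arguments. Unset Strict Implicit. Unset Printing Implicit Defensive.
Import GRing.Theory.
Local Open Scope ring_scope.

(** An isomorphism of binary matroids is the same thing as a linear bijection [T] between
    the ambient spaces that preserves, for every vector, the number of columns equal to it.
    The graph isomorphism is built by induction on the number of vertices.

    For a leaf [l] at [w], the coordinate functional at [l] is nonzero on exactly four
    columns, those of [l] and [w] other than [phi w]; functionals with this property come
    only from leaves, pairs of twin leaves and isolated edges (and isolated vertices, which
    are split off first).  So [T] carries [{l, w}] to such a configuration in the second
    forest.  Composing [T] with explicit automorphisms of the second matroid (local
    complementation at a leaf, pivot on a pendant edge, and a sporadic automorphism when a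
    component is a path on four vertices) makes [T] respect the vertex triples of a leaf
    [l'] and its neighbour [w'].  Contracting [phi l] and [phi l'] then deletes both leaves.
    To remember that the leaves were attached at [w] and [w'], the pair [(w, w')] is pinned:
    from then on the graph isomorphism is required to map [w] to [w'], and all later
    modifications of [T] have to respect the vertex triple of [w']. *)

(** * Columns as vectors over GF(2) *)

Notation vec V := {ffun V -> bool}.

Definition phi (V : finType) (v : V) : vec V := [ffun u => u == v].
Definition chi (V : finType) (e : rel V) (v : V) : vec V := [ffun u => e u v].
(** GF(2) is realised here by [bool], whose addition is exclusive or; [IAS_colE] relates these
    columns to [IAS_col]. *)
Definition col (V : finType) (e : rel V) (w : Wg V) : vec V :=
  let: (v, k) := w in
  match val k with
  | 0 => phi v
  | 1 => chi e v
  | _ => chi e v + phi v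
  end.
(** For a nonzero vector this is the size of its (possibly empty) parallel class in the matroid; at
    zero it counts the loops. *)
Definition mult (V : finType) (e : rel V) (x : vec V) : nat :=
  #|[pred w | col e w == x]|.

(** Between spaces over GF(2) the additive maps are exactly the linear ones. *)
Definition additive_fun (U W : zmodType) (f : U -> W) : Prop :=
  {morph f : x y / x + y}.

(* Besides the existence of a vertex of degree at most one, this is all that is used of a
   forest: no triangle and no 4-cycle. *)
Definition thin (V : finType) (e : rel V) : Prop :=
  [/\ symmetric e, irreflexive e,
      (forall x y z, e x y -> e y z -> e x z -> False) &
      (forall a b u v, a != b -> e a u -> e a v -> e b u -> e b v -> u = v)].

(** * Short cycles and vertices of small degree in a forest *)

Lemma forest_thin (V : finType) (e : rel V) : forest e -> thin e.
Proof.
move=> [[sym irr] acyc].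
have neq x y : e x y -> x != y.
  by move=> exy; apply/eqP => xy; rewrite xy irr in exy.
split=> // [x y z exy eyz exz|a b u v ab eau eav ebu ebv].
  have := acyc [:: x; y; z] isT.
  by rewrite /= !inE !negb_or !neq // exy eyz (sym z x) exz => /(_ isT).
apply/eqP/negPn/negP => uv.
have := acyc [:: a; u; b; v] isT.
rewrite /= !inE !negb_or ab uv eau ebv (sym u b) ebu (sym v a) eav.
by rewrite !neq //= 1?sym // => /(_ isT).
Qed.

(** If every vertex had two distinct neighbours, a path could always be prolonged at its first
    vertex, until it has more vertices than the graph. *)
Lemma acyclic_deg_le1 (V : finType) (e : rel V) (x0 : V) :
  forest e -> exists v, forall a b, e v a -> e v b -> a = b.
Proof.
move=> [[sym irr] acyc].
pose deg_le1 v := [forall a, forall b, e v a ==> e v b ==> (a == b)].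
case: (pickP deg_le1) => [v /forallP dv|no].
  exists v => a b va vb; apply/eqP.
  by have /forallP/(_ b) := dv a; rewrite va vb.
have long n : exists x p, [/\ path e x p, uniq (x :: p) & size p = n].
  elim: n => [|n [x [p [pp up sp]]]]; first by exists x0, [::].
  (* [head x p] is the second vertex of the path; for empty [p] it is [x], which is no neighbour of
     itself anyway. *)
  have [y [exy ynp]] : exists y, e x y /\ y != head x p.
    have /negbT := no x; rewrite negb_forall => /existsP[a].
    rewrite negb_forall => /existsP[b]; rewrite !negb_imply => /and3P[xa xb ab].
    case: (eqVneq a (head x p)) => [ha|]; last by exists a.
    by exists b; rewrite -ha eq_sym.
  case yp: (y \in x :: p); last first.
    exists y, (x :: p); split=> /=; rewrite ?sp //.
      by rewrite sym exy.
    by rewrite yp.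
  move: yp; rewrite inE => /orP[/eqP xy|yp]; first by rewrite xy irr in exy.
  (* [y] lies on the path but is not its second vertex, so the segment from [x] to [y] closes up to
     a cycle with at least three vertices. *)
  case/splitPr: yp pp up sp ynp => [[|z p1] p2] pp up _; first by rewrite /= eqxx.
  move=> _; exfalso.
  have uc : uniq (rcons (x :: z :: p1) y).
    by move: up; rewrite -cat_cons -cat_rcons cat_uniq => /and3P[].
  have cc : cycle e (rcons (x :: z :: p1) y).
    move: pp; rewrite /= cat_path /= => /and3P[-> pp1 /andP[ly _]].
    by rewrite rcons_path rcons_path pp1 ly last_rcons sym exy.
  by have := acyc (rcons (x :: z :: p1) y); rewrite size_rcons uc cc => /(_ isT isT).
have [x [p [_ up sp]]] := long #|V|.
by have := card_uniqP up; have := max_card [in x :: p]; rewrite /= sp => /[swap]->; rewrite ltnn.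
Qed.

(** * Additive maps on vectors *)

Lemma vec_addxx (V : finType) (x : vec V) : x + x = 0.
Proof. by apply/ffunP=> u; rewrite !ffunE; case: (x u). Qed.

Lemma vec_addxK (V : finType) (x y : vec V) : x + y + y = x.
Proof. by rewrite -addrA vec_addxx addr0. Qed.

Lemma additive_fun0 (U W : zmodType) (f : U -> W) : additive_fun f -> f 0 = 0.
Proof. by move=> fD; apply: (@addrI _ (f 0)); rewrite -fD !addr0. Qed.

Lemma additive_inv (U W : zmodType) (f : U -> W) g :
  additive_fun f -> cancel f g -> cancel g f -> additive_fun g.
Proof. by move=> fD fK gK x y; rewrite -{1}(gK x) -{1}(gK y) -fD fK. Qed.

Lemma vec_sum (V : finType) (x : vec V) :
  x = \sum_u (if x u then phi u else 0).
Proof.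
apply/ffunP=> v; rewrite sum_ffunE (bigD1 v) //= big1 ?addr0 => [|u uv].
  by case xv: (x v); rewrite !ffunE ?eqxx.
by case: (x u); rewrite !ffunE // eq_sym (negPf uv).
Qed.

Lemma additive_expand (V : finType) (W : zmodType) (f : vec V -> W) (x : vec V) :
  additive_fun f -> f x = \sum_u (if x u then f (phi u) else 0).
Proof.
move=> fD; have f0 := additive_fun0 fD.
rewrite {1}[x]vec_sum (big_morph f fD f0).
by apply: eq_bigr => u _; case: (x u).
Qed.

Lemma additive_eq (V : finType) (W : zmodType) (f g : vec V -> W) :
  additive_fun f -> additive_fun g -> (forall v, f (phi v) = g (phi v)) -> f =1 g.
Proof.
move=> fD gD fg x; rewrite (additive_expand x fD) (additive_expand x gD).
by apply: eq_bigr => u _; rewrite fg.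
Qed.

Lemma functional_pair (V : finType) (f : vec V -> bool) (a b : V) :
  additive_fun f -> a != b ->
  (forall v, v != a -> v != b -> f (phi v) = false) ->
  forall x, f x = (x a && f (phi a)) (+) (x b && f (phi b)).
Proof.
move=> fD ab f0 x.
have gD : additive_fun (fun y : vec V => (y a && f (phi a)) (+) (y b && f (phi b))).
  by move=> y z; rewrite !ffunE; case: (y a) (y b) (z a) (z b) (f _) (f _) => [] [] [] [] [] [].
rewrite (additive_eq fD gD) // => v; rewrite /= !ffunE !(eq_sym _ v).
case: (eqVneq v a) => [->|va]; first by rewrite (negPf ab) addbF.
by case: (eqVneq v b) => [->|vb] //; rewrite f0.
Qed.

Lemma functional_single (V : finType) (f : vec V -> bool) (a : V) :
  additive_fun f -> (forall v, v != a -> f (phi v) = false) ->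
  forall x, f x = x a && f (phi a).
Proof.
move=> fD f0 x.
have gD : additive_fun (fun y : vec V => y a && f (phi a)).
  by move=> y z; rewrite !ffunE; case: (y a) (z a) (f _) => [] [] [].
rewrite (additive_eq fD gD) // => v; rewrite /= !ffunE eq_sym.
by case: (eqVneq v a) => [->|va] //; rewrite f0.
Qed.

Lemma vec_at (V : finType) (x y : vec V) (u : V) : x = y -> x u = y u.
Proof. by move=> ->. Qed.

Lemma phiE (V : finType) (v u : V) : phi v u = (u == v).
Proof. by rewrite ffunE. Qed.

Lemma chiE (V : finType) (e : rel V) (v u : V) : chi e v u = e u v.
Proof. by rewrite ffunE. Qed.

Lemma vecDE (V : finType) (x y : vec V) (u : V) : (x + y) u = x u (+) y u.
Proof. by rewrite ffunE. Qed.

Lemma vec0E (V : finType) (u : V) : (0 : vec V) u = false.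
Proof. by rewrite ffunE. Qed.

Definition vecE := (phiE, chiE, vecDE, vec0E).

Lemma phi_inj (V : finType) : injective (@phi V).
Proof. by move=> v v' /(vec_at v); rewrite !vecE eqxx => /esym/eqP. Qed.

Lemma phi_neq0 (V : finType) (v : V) : phi v <> 0.
Proof. by move/(vec_at v); rewrite !vecE eqxx. Qed.

(** * Columns and their multiplicities *)

Definition is_col (V : finType) (e : rel V) (x : vec V) : Prop :=
  exists v, [\/ x = phi v, x = chi e v | x = chi e v + phi v].

Lemma col_is_col (V : finType) (e : rel V) (w : Wg V) : is_col e (col e w).
Proof.
case: w => v [[|[|k]] lt_k]; exists v; first by constructor 1.
  by constructor 2.
by constructor 3.
Qed.

Lemma mult_gt0P (V : finType) (e : rel V) (x : vec V) :
  (0 < mult e x)%N <-> is_col e x.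
Proof.
split=> [/card_gt0P[w /eqP <-]|[v vx]]; first exact: col_is_col.
apply/card_gt0P; case: vx => ->.
- by exists (v, ord0); rewrite inE.
- by exists (v, Ordinal (isT : (1 < 3)%N)); rewrite inE.
- by exists (v, Ordinal (isT : (2 < 3)%N)); rewrite inE.
Qed.

Definition no_isolated (V : finType) (e : rel V) : Prop :=
  forall v, chi e v <> 0.

Lemma no_isolatedP (V : finType) (e : rel V) (v : V) :
  no_isolated e -> exists u, e u v.
Proof.
move=> ni; case: (pickP (fun u => e u v)) => [u|no]; first by exists u.
by case: (ni v); apply/ffunP=> u; rewrite !vecE no.
Qed.

(** Only the [chi] of an isolated vertex is a zero column, since [psi] has a one on the diagonal.
    Thus isolated vertices can be detected from multiplicities. *)
Lemma no_isolated_mult (V : finType) (e : rel V) :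
  irreflexive e -> no_isolated e <-> mult e 0 = 0%N.
Proof.
move=> irr; split=> [ni|m0 v v0].
  apply/eqP; rewrite -leqn0 leqNgt; apply/negP => /mult_gt0P[v].
  case=> [/esym/phi_neq0//|/esym/ni//|/(vec_at v)].
  by rewrite !vecE irr eqxx.
have : (0 < mult e 0%R)%N by apply: (mult_gt0P e 0).2; exists v; constructor 2.
by rewrite m0.
Qed.

(** Compare two equal columns by type. A [phi] and a [chi] give a leaf; two [chi] give equal
    neighbourhoods, hence twin leaves as there is no 4-cycle; two [psi] give adjacent vertices with
    the same other neighbours, hence an isolated edge as there is no triangle. A [psi] never equals
    a column of another type. *)
Lemma mult_gt1_cases (V : finType) (e : rel V) (x : vec V) :
  thin e -> no_isolated e -> (1 < mult e x)%N ->
  (exists c d, chi e d = phi c /\ x = phi c) \/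
  (exists s t, [/\ chi e s = phi t, chi e t = phi s & x = phi s + phi t]).
Proof.
move=> [sym irr no3 no4] ni /card_gt1P[w1 [w2 [/eqP xw1 /eqP xw2 w12]]].
have phi_psi v v' : phi v <> chi e v' + phi v'.
  move=> eq_v; have := vec_at v' eq_v; rewrite !vecE irr eqxx => /eqP vv'.
  by case: (ni v'); apply: (@addIr _ (phi v')); rewrite -eq_v add0r vv'.
have chi_psi v v' : chi e v <> chi e v' + phi v'.
  move=> eq_v; have := vec_at v' eq_v; rewrite !vecE irr eqxx => /= vv'.
  have := vec_at v eq_v; rewrite !vecE irr sym vv'.
  by case: eqP => // ve; rewrite ve irr in vv'.
move: xw1 xw2 w12; case: w1 w2 => [v1 [[|[|k1]] lt1]] [v2 [[|[|k2]] lt2]] /= <-.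
- by move/phi_inj=> ->; rewrite xpair_eqE -val_eqE /= !eqxx.
- by move=> v12 _; left; exists v1, v2.
- by move/esym/phi_psi.
- by move=> v12 _; left; exists v2, v1.
- move=> v12; rewrite xpair_eqE -val_eqE /= andbT => neq12; left.
  have [u uv1] := no_isolatedP v1 ni.
  suff uE : chi e v1 = phi u by exists u, v1.
  apply/ffunP=> u'; rewrite !vecE; apply/idP/eqP => [u'v1|->//].
  apply: (no4 v1 v2) => //; rewrite sym //; have := vec_at u v12; have := vec_at u' v12.
    by rewrite !vecE u'v1.
  by rewrite !vecE uv1.
- by move/esym/chi_psi.
- by move/phi_psi.
- by move/chi_psi.
- move=> v12; rewrite xpair_eqE negb_and => neq12; right.
  have {}neq12 : v1 != v2.
    by case/orP: neq12 => // /negP[]; case: k1 k2 lt1 lt2 v12 => [|//] [|//] *; apply/eqP/val_inj.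
  have e12 : e v1 v2.
    have := vec_at v1 v12; rewrite !vecE irr eqxx (negPf neq12) /=.
    by rewrite addbF.
  have nbr u : u != v1 -> u != v2 -> e u v1 = false /\ e u v2 = false.
    move=> uv1 uv2; have := vec_at u v12.
    rewrite !vecE (negPf uv1) (negPf uv2) !addbF => eu.
    by case eu2: (e u v2) eu => // eu1; case: (no3 u v1 v2).
  have c1 : chi e v1 = phi v2.
    apply/ffunP=> u; rewrite !vecE; case: (eqVneq u v2) => [->|uv2]; first by rewrite sym.
    case: (eqVneq u v1) => [->|uv1]; first by rewrite irr.
    by case: (nbr u).
  have c2 : chi e v2 = phi v1.
    apply/ffunP=> u; rewrite !vecE; case: (eqVneq u v1) => [->//|uv1].
    case: (eqVneq u v2) => [->|uv2]; first by rewrite irr.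
    by case: (nbr u).
  by exists v1, v2; rewrite c1 c2 addrC; split=> //; rewrite addrC -c1.
Qed.

(** * Columns and functionals at leaves, twin leaves and isolated edges *)

Lemma leaf_adj (V : finType) (e : rel V) (a b u : V) :
  chi e a = phi b -> e u a = (u == b).
Proof. by move/(vec_at u); rewrite !vecE. Qed.

Lemma leaf_neq (V : finType) (e : rel V) (a b : V) :
  irreflexive e -> chi e a = phi b -> a != b.
Proof. by move=> irr /(leaf_adj a); rewrite irr => /esym/negbT. Qed.

Lemma col_at_leaf (V : finType) (e : rel V) (a b : V) (x : vec V) :
  symmetric e -> chi e a = phi b -> is_col e x -> x a ->
  (x = phi a \/ x = phi a + phi b) \/ (x = chi e b \/ x = chi e b + phi b).
Proof.
move=> sym ab [v [] ->]; rewrite !vecE.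
- by move=> /eqP ->; left; left.
- by rewrite sym (leaf_adj v ab) => /eqP ->; right; left.
- rewrite sym (leaf_adj v ab); case: (eqVneq a v) => [<- _|_].
    by left; right; rewrite ab addrC.
  by rewrite addbF => /eqP ->; right; right.
Qed.

(** The sum of the coordinates at twin leaves cancels on the columns of their neighbour [c], so only
    [phi] and [psi] of the two leaves survive. *)
Lemma col_at_twins (V : finType) (e : rel V) (a b c : V) (x : vec V) :
  symmetric e -> chi e a = phi c -> chi e b = phi c -> is_col e x -> x a (+) x b ->
  (x = phi a \/ x = phi a + phi c) \/ (x = phi b \/ x = phi b + phi c).
Proof.
move=> sym ac bc [v [] ->]; rewrite !vecE.
- case: (eqVneq a v) => [->|_ /= /eqP ->]; first by left; left.
  by right; left.
- by rewrite ![e _ v]sym (leaf_adj v ac) (leaf_adj v bc) addbb.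
- rewrite ![e _ v]sym (leaf_adj v ac) (leaf_adj v bc).
  case: (eqVneq a v) => [<- _|_]; first by left; right; rewrite ac addrC.
  case: (eqVneq b v) => [<- _|_]; first by right; right; rewrite bc addrC.
  by rewrite !addbF addbb.
Qed.

(** Excludes candidates for the image of [phi w], which is repeated when [w] carries a leaf. A
    repeated vector with both coordinates [a] and [b] nonzero would make [a b] an isolated edge, but
    both are leaves at [c]. *)
Lemma mult_twins_sum (V : finType) (e : rel V) (a b c : V) (x : vec V) :
  thin e -> no_isolated e -> a != b -> chi e a = phi c -> chi e b = phi c ->
  x = phi a + phi b \/ x = phi a + phi b + phi c -> (mult e x <= 1)%N.
Proof.
move=> th ni ab ac bc xE; have [sym irr _ _] := th.
have nac := leaf_neq irr ac; have nbc := leaf_neq irr bc.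
rewrite leqNgt; apply/negP => /(mult_gt1_cases th ni).
have [xa xb] : x a /\ x b.
  case: xE => ->; rewrite !vecE !eqxx (negPf ab) ?(negPf nac) ?(negPf nbc);
    by rewrite eq_sym (negPf ab).
case=> [[d [_ [_ xd]]]|[s [t [st ts xst]]]].
  by move: xa xb ab; rewrite xd !vecE => /eqP -> /eqP ->; rewrite eqxx.
have k2 s' t' : chi e s' = phi t' -> chi e t' = phi s' -> x = phi s' + phi t' -> a = s' -> False.
  move=> st' ts' xst' as'; rewrite -{}as' in st' ts' xst' *.
  have tc : t' = c by apply: phi_inj; rewrite -ac.
  by move: xb; rewrite xst' !vecE tc (negPf nbc) addbF eq_sym (negPf ab).
move: xa; rewrite xst !vecE; case: (eqVneq a s) => [as_ _|_ /= /eqP at_].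
  exact: k2 st ts xst as_.
by apply: (k2 t s) => //; rewrite addrC.
Qed.

(** The vector is [chi e b] without the leaf [a], up to [phi b]. The classification of repeated
    columns leaves only the case of a single further neighbour [c] of [b], carrying a leaf [d]. This
    is where paths on four vertices enter. *)
Lemma mult_leaf_sum (V : finType) (e : rel V) (a b : V) (x : vec V) :
  thin e -> no_isolated e -> chi e a = phi b -> chi e b <> phi a ->
  x = phi a + chi e b \/ x = phi a + chi e b + phi b -> (1 < mult e x)%N ->
  exists c d, [/\ chi e b = phi a + phi c, chi e d = phi c & x = phi c].
Proof.
move=> th ni ab nba xE mx; have [sym irr _ _] := th.
have nab := leaf_neq irr ab.
have eab : e a b by rewrite sym (leaf_adj b ab).
case: (mult_gt1_cases th ni mx) => [[c [d [dc xc]]]|[s [t [st ts xst]]]].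
  exists c, d; split=> //; case: xE => xE.
    by rewrite -xc xE addrA vec_addxx add0r.
  have := vec_at b xE; rewrite xc !vecE irr eqxx (eq_sym b a) (negPf nab) => /= /eqP bc.
  case: nba; apply: (@addrI _ (phi a)); rewrite vec_addxx; apply: (@addIr _ (phi b)).
  by rewrite -xE xc bc add0r.
exfalso.
have nbr s' t' : chi e s' = phi t' -> e s' b -> t' = b.
  by move=> st'; rewrite sym (leaf_adj b st') => /eqP.
have nst := leaf_neq irr st.
case: xE => xE.
  have xb : x b = false by rewrite xE !vecE irr (eq_sym b a) (negPf nab).
  have xs : x s by rewrite xst !vecE eqxx (negPf nst).
  have [bs bt] : b != s /\ b != t.
    move: xb; rewrite xst !vecE; case: (eqVneq b s) => [->|_]; first by rewrite (negPf nst).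
    by move=> /= ->.
  move: xs; rewrite xE !vecE; case: eqP => [sa _|_ /= esb].
    by move: bt; rewrite -(phi_inj (etrans (esym st) (etrans (congr1 _ sa) ab))) eqxx.
  by rewrite (nbr _ _ st esb) eqxx in bt.
have k2 s' t' : chi e s' = phi t' -> chi e t' = phi s' -> b = s' -> False.
  move=> st' ts' bs; rewrite -{}bs in st' ts'.
  have := leaf_adj a st'; rewrite eab => /esym/eqP ta.
  by case: nba; rewrite ta.
have : x b by rewrite xE !vecE irr eqxx (eq_sym b a) (negPf nab).
rewrite xst !vecE; case: (eqVneq b s) => [bs _|_ /= /eqP bt].
  exact: k2 st ts bs.
exact: k2 ts st bt.
Qed.

(** Such an [f] is a combination of the coordinates at [a] and [b]. If only one occurs, its vertex
    has no neighbour besides the other. If both occur, vanishing of [f] on the remaining [chi]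
    columns says that [a] and [b] have the same other neighbours: adjacent ones form an isolated
    edge (no triangle), nonadjacent ones are twin leaves (no 4-cycle). *)
Lemma functional_support2 (V : finType) (e : rel V) (f : vec V -> bool) (a b : V) :
  thin e -> no_isolated e -> additive_fun f -> a != b ->
  (forall v, f (phi v) || f (chi e v) = (v == a) || (v == b)) ->
  [\/ chi e a = phi b /\ (forall x, f x = x a),
      chi e b = phi a /\ (forall x, f x = x b),
      [/\ chi e a = phi b, chi e b = phi a & forall x, f x = x a (+) x b] |
      exists c, [/\ chi e a = phi c, chi e b = phi c & forall x, f x = x a (+) x b]].
Proof.
move=> th ni fD ab supp; have [sym irr no3 no4] := th.
have nsupp v : v != a -> v != b -> f (phi v) = false /\ f (chi e v) = false.
  move=> va vb; have := supp v; rewrite (negPf va) (negPf vb).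
  by case: (f _) (f _) => [] [].
have fE := functional_pair fD ab (fun v va vb => proj1 (nsupp v va vb)).
have fchi v : v != a -> v != b -> (e a v && f (phi a)) = (e b v && f (phi b)).
  move=> va vb; have [_] := nsupp v va vb; rewrite fE !vecE.
  by case: (_ && _) (_ && _) => [] [].
have leafP u v : u != v -> (forall w, w != u -> w != v -> e u w = false) -> chi e u = phi v.
  move=> uv no; have sub w : e w u -> w = v.
    rewrite sym => euw; apply/eqP/negPn/negP => wv.
    have wu : w != u by apply: contraTneq euw => ->; rewrite irr.
    by rewrite no in euw.
  have [w wu] := no_isolatedP u ni.
  by apply/ffunP=> z; rewrite !vecE; apply/idP/eqP => [/sub//|->]; rewrite -(sub w).
case fa: (f (phi a)) fE fchi => fE fchi; case fb: (f (phi b)) fE fchi => fE fchi.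
- have same v : v != a -> v != b -> e a v = e b v.
    by move=> va vb; have := fchi v va vb; rewrite !andbT.
  have {}fE x : f x = x a (+) x b by rewrite fE !andbT.
  case eab: (e a b).
    constructor 3; split=> //.
      apply: leafP => // v va vb; case eav: (e a v) => //.
      by case: (no3 a b v) => //; rewrite -same.
    apply: leafP => [|v vb va]; first by rewrite eq_sym.
    by case ebv: (e b v) => //; case: (no3 a b v) => //; rewrite same.
  constructor 4; have [c ca] := no_isolatedP a ni.
  have [na nb] : c != a /\ c != b.
    split; apply: contraTneq ca => ->; first by rewrite irr.
    by rewrite sym eab.
  have cb : e c b by rewrite sym -same // sym.
  exists c; split=> //; apply/ffunP=> v; rewrite !vecE; apply/idP/eqP => [ev|->//].
    have [va vb] : v != a /\ v != b.
      split; apply: contraTneq ev => ->; first by rewrite irr.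
      by rewrite sym eab.
    by apply: (no4 a b) => //; rewrite sym // sym -same // sym.
  have [va vb] : v != a /\ v != b.
    split; apply: contraTneq ev => ->; last by rewrite irr.
    by rewrite eab.
  by apply: (no4 a b) => //; rewrite sym // sym same // sym.
- constructor 1; split=> [|x]; last by rewrite fE andbT andbF addbF.
  by apply: leafP => // v va vb; have := fchi v va vb; rewrite andbT andbF.
- constructor 2; split=> [|x]; last by rewrite fE andbT andbF.
  by apply: leafP; rewrite 1?eq_sym // => v vb va; have := fchi v va vb; rewrite andbT andbF.
- have := supp a; rewrite eqxx fa /= fE !andbF; by [].
Qed.

(** * Support sizes and multiplicity-preserving linear bijections *)

Lemma card_col (V : finType) (e : rel V) (P : pred (vec V)) :
  #|[pred w | P (col e w)]| = (\sum_(x | P x) mult e x)%N.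
Proof.
rewrite -sum1_card (partition_big (col e) P) //=; apply: eq_bigr => x Px.
rewrite /mult -sum1_card; apply: eq_bigl => w.
by rewrite !inE; case: eqP => [->|_]; rewrite ?Px ?andbF.
Qed.

(** The three columns of a vertex sum to zero, so [f] is nonzero on either none or exactly two of
    them. *)
Lemma card_support (V : finType) (e : rel V) (f : vec V -> bool) :
  additive_fun f ->
  #|[pred w | f (col e w)]| = (#|[pred v | f (phi v) || f (chi e v)]| * 2)%N.
Proof.
move=> fD; rewrite -sum1_card big_mkcond.
rewrite (eq_bigr (fun w : Wg V => (f (col e (w.1, w.2)) : nat))); last first.
  by case=> v k _; rewrite inE; case: (f _).
rewrite -(pair_big predT predT (fun v k => f (col e (v, k)) : nat)) /=.
rewrite -sum1_card big_distrl /= big_mkcond [in RHS]big_mkcond /=.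
apply: eq_bigr => v _; rewrite !big_ord_recl big_ord0 /= fD inE.
by case: (f _) (f _) => [] [].
Qed.

(* The columns chi and psi = chi + phi of a pinned vertex may be exchanged by [T], as they
   are by local complementation at a neighbour. *)
Record pinned_iso (V1 V2 : finType) (e1 : rel V1) (e2 : rel V2)
    (R : V1 -> V2 -> Prop) (T : vec V1 -> vec V2) (T' : vec V2 -> vec V1) : Prop :=
  PinnedIso {
    pi_add : additive_fun T;
    pi_K : cancel T T';
    pi_K' : cancel T' T;
    pi_mult : forall x, mult e2 (T x) = mult e1 x;
    pi_phi : forall v v', R v v' -> T (phi v) = phi v';
    pi_chi : forall v v', R v v' ->
      T (chi e1 v) = chi e2 v' \/ T (chi e1 v) = chi e2 v' + phi v'
  }.

Section PinnedIsoTheory.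
Context (V1 V2 : finType) (e1 : rel V1) (e2 : rel V2) (R : V1 -> V2 -> Prop).
Context (T : vec V1 -> vec V2) (T' : vec V2 -> vec V1).
Hypothesis TT' : pinned_iso e1 e2 R T T'.

Lemma pi_add' : additive_fun T'.
Proof. exact: (additive_inv (pi_add TT') (pi_K TT') (pi_K' TT')). Qed.

Lemma pi_inj : injective T.
Proof. exact: can_inj (pi_K TT'). Qed.

Lemma pi_is_col x : is_col e1 x -> is_col e2 (T x).
Proof. by move/mult_gt0P => mx; apply/mult_gt0P; rewrite (pi_mult TT'). Qed.

Lemma pi_no_isolated :
  irreflexive e1 -> irreflexive e2 -> no_isolated e1 -> no_isolated e2.
Proof.
move=> irr1 irr2 /(no_isolated_mult irr1) m1; apply/(no_isolated_mult irr2).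
by rewrite -(additive_fun0 (pi_add TT')) (pi_mult TT').
Qed.

(** By [card_support] the number of vertex triples on which a functional is not identically zero
    depends only on multiplicities. It is thus kept by [T], even if [T] does not map triples to
    triples. *)
Lemma pi_card_support (f : vec V1 -> bool) : additive_fun f ->
  #|[pred v | f (T' (phi v)) || f (T' (chi e2 v))]| =
  #|[pred v | f (phi v) || f (chi e1 v)]|.
Proof.
move=> fD; have f'D : additive_fun (f \o T') by move=> x y; rewrite /= pi_add' fD.
apply/eqP; rewrite -(eqn_pmul2r (isT : 0 < 2)%N) -(card_support e1 fD).
rewrite -(card_support e2 f'D) !card_col; apply/eqP.
rewrite (reindex T); last by exists T' => x _; [exact: (pi_K TT')|exact: (pi_K' TT')].
apply: eq_big => [x|x _]; first by rewrite /= (pi_K TT').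
exact: (pi_mult TT').
Qed.

End PinnedIsoTheory.

(** * The image of the coordinate functional at a leaf *)

Lemma card2_enum (V : finType) (P : pred V) :
  #|P| = 2%N -> exists a b, a != b /\ forall v, P v = (v == a) || (v == b).
Proof.
rewrite -cardsE => /eqP/cards2P[a [b [ab PE]]]; exists a, b; split=> // v.
by have /setP/(_ v) := PE; rewrite !inE.
Qed.

(** The coordinate at [l] is nonzero only on the triples of [l] and [w]. Its transport is therefore
    supported on two triples as well, and [functional_support2] applies. *)
Lemma leaf_functional_image (V1 V2 : finType) (e1 : rel V1) (e2 : rel V2) R T T' l w :
  thin e1 -> thin e2 -> no_isolated e1 -> pinned_iso e1 e2 R T T' ->
  chi e1 l = phi w ->
  exists a b, [\/ chi e2 a = phi b /\ (forall x, T' x l = x a),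
    [/\ chi e2 a = phi b, chi e2 b = phi a & forall x, T' x l = x a (+) x b] |
    exists c, [/\ a != b, chi e2 a = phi c, chi e2 b = phi c &
      forall x, T' x l = x a (+) x b]].
Proof.
move=> th1 th2 ni1 TT' lw; have [sym1 irr1 _ _] := th1; have [_ irr2 _ _] := th2.
have ni2 := pi_no_isolated TT' irr1 irr2 ni1.
pose f (x : vec V1) := x l; have fD : additive_fun f by move=> x y; rewrite /f vecDE.
have f'D : additive_fun (fun x => f (T' x)).
  by move=> x y; rewrite (pi_add' TT') fD.
have : #|[pred v | f (phi v) || f (chi e1 v)]| = 2%N.
  have <- : #|[set l; w]| = 2%N by rewrite cards2 (leaf_neq irr1 lw).
  apply: eq_card => v.
  by rewrite !inE /f !vecE sym1 (leaf_adj v lw) eq_sym.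
rewrite -(pi_card_support TT' fD) => /card2_enum[a [b [ab supp]]].
case: (functional_support2 th2 ni2 f'D ab supp) => [[ab' fE]|[ba' fE]|[ab' ba' fE]|[c [ac bc fE]]].
- by exists a, b; constructor 1.
- by exists b, a; constructor 1.
- by exists a, b; constructor 2.
- by exists a, b; constructor 3; exists c.
Qed.

Lemma col_at_K2 (V : finType) (e : rel V) (a b : V) (x : vec V) :
  symmetric e -> chi e a = phi b -> chi e b = phi a -> is_col e x ->
  x a (+) x b -> x = phi a \/ x = phi b.
Proof.
move=> sym ab ba [v [] ->]; rewrite !vecE.
- case: (eqVneq a v) => [->|_ /= /eqP ->]; first by left.
  by right.
- rewrite ![e _ v]sym (leaf_adj v ab) (leaf_adj v ba).
  case: (eqVneq v b) => [->|_ /= /eqP ->]; first by left.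
  by right.
- rewrite ![e _ v]sym (leaf_adj v ab) (leaf_adj v ba) ![_ == v]eq_sym.
  by case: (v == a) (v == b) => [] [].
Qed.

(** Used with [x] the image of [phi l] and [t] that of [phi w]: both [phi l] and
    [psi l = phi l + phi w] go to one of the four columns seen by the transported functional. *)
Lemma quad_diff (V : finType) (y z p x t : vec V) :
  (x = y \/ x = y + p) \/ (x = z \/ x = z + p) ->
  (x + t = y \/ x + t = y + p) \/ (x + t = z \/ x + t = z + p) ->
  [\/ t = 0, t = p, t = y + z | t = y + z + p].
Proof.
have tE : t = x + (x + t) by rewrite addrA vec_addxx add0r.
move: (x + t) tE => s -> xQ xtQ; case: xQ => [[]|[]] ->; case: xtQ => [[]|[]] ->;
  do [constructor 1; apply/ffunP=> u; rewrite !vecE;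
      by case: (y u) (z u) (p u) => [] [] []
     |constructor 2; apply/ffunP=> u; rewrite !vecE;
      by case: (y u) (z u) (p u) => [] [] []
     |constructor 3; apply/ffunP=> u; rewrite !vecE;
      by case: (y u) (z u) (p u) => [] [] []
     |constructor 4; apply/ffunP=> u; rewrite !vecE;
      by case: (y u) (z u) (p u) => [] [] []].
Qed.

Lemma mult_phi_leaf (V : finType) (e : rel V) (l w : V) :
  chi e l = phi w -> (1 < mult e (phi w))%N.
Proof.
move=> lw; apply/card_gt1P.
by exists (w, ord0), (l, Ordinal (isT : (1 < 3)%N)); rewrite !inE /= lw !eqxx xpair_eqE andbF.
Qed.

Lemma leaf_image_cols (V1 V2 : finType) (e1 : rel V1) (e2 : rel V2) R T T' l w :
  thin e1 -> pinned_iso e1 e2 R T T' -> chi e1 l = phi w ->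
  forall x, [\/ x = phi l, x = phi l + phi w, x = chi e1 w | x = chi e1 w + phi w] ->
  is_col e2 (T x) /\ T' (T x) l.
Proof.
move=> [sym1 irr1 _ _] TT' lw x xE; have lw_neq := leaf_neq irr1 lw.
rewrite (pi_K TT'); split.
  apply: (pi_is_col TT'); case: xE => ->; last 2 first.
  - by exists w; constructor 2.
  - by exists w; constructor 3.
  - by exists l; constructor 1.
  - by exists l; constructor 3; rewrite lw addrC.
by case: xE => ->; rewrite !vecE ?eqxx ?(negPf lw_neq) // sym1 (leaf_adj w lw) eqxx.
Qed.

Lemma chi_support_neq (V : finType) (e : rel V) (l w : V) :
  irreflexive e -> chi e l = phi w -> chi e w <> phi l + phi w.
Proof.
move=> irr lw /(vec_at w); rewrite !vecE irr eqxx eq_sym.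
by rewrite (negPf (leaf_neq irr lw)).
Qed.

(* In the third case [T] does not respect the triples of [l] and [w]; it arises only if
   a component is a path on four vertices, see [support_image_fix]. *)
Lemma support_image (V1 V2 : finType) (e1 : rel V1) (e2 : rel V2) R T T' l w :
  thin e1 -> thin e2 -> no_isolated e1 -> pinned_iso e1 e2 R T T' ->
  chi e1 l = phi w -> chi e1 w <> phi l ->
  [\/ exists a b, [/\ chi e2 a = phi b, forall x, T' x l = x a & T (phi w) = phi b],
      exists a b c, [/\ a != b, chi e2 a = phi c, chi e2 b = phi c,
         forall x, T' x l = x a (+) x b & T (phi w) = phi c] |
      exists a b c d, [/\ chi e2 a = phi b, forall x, T' x l = x a,
         chi e2 b = phi a + phi c, chi e2 d = phi c & T (phi w) = phi c]].
Proof.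
move=> th1 th2 ni1 TT' lw nwl; have [sym1 irr1 _ _] := th1; have [sym2 irr2 _ _] := th2.
have ni2 := pi_no_isolated TT' irr1 irr2 ni1.
have img := leaf_image_cols th1 TT' lw.
have TD := pi_add TT'.
have [c1 f1] := img _ (Or41 _ _ _ erefl).
have [c2 f2] := img _ (Or42 _ _ _ erefl).
have [c3 f3] := img _ (Or43 _ _ _ erefl).
rewrite TD in c2 f2.
have Tw0 : T (phi w) <> 0.
  by rewrite -(additive_fun0 TD) => /(pi_inj TT')/phi_neq0.
have mTw : (1 < mult e2 (T (phi w)))%N by rewrite (pi_mult TT') (mult_phi_leaf lw).
have [a [b []]] := leaf_functional_image th1 th2 ni1 TT' lw.
- move=> [ab fE]; rewrite !fE in f1 f2.
  case: (quad_diff (col_at_leaf sym2 ab c1 f1) (col_at_leaf sym2 ab c2 f2)) => //.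
  + by move=> Tw; constructor 1; exists a, b.
  + move=> Tw; have nba : chi e2 b <> phi a.
      by move=> ba; apply: Tw0; rewrite Tw ba vec_addxx.
    have [c [d [bc dc Twc]]] := mult_leaf_sum th2 ni2 ab nba (or_introl Tw) mTw.
    by constructor 3; exists a, b, c, d.
  + move=> Tw; case: (eqVneq (chi e2 b) (phi a)) => [ba|/eqP nba].
      by constructor 1; exists a, b; split=> //; rewrite Tw ba vec_addxx add0r.
    have [c [d [bc dc Twc]]] := mult_leaf_sum th2 ni2 ab nba (or_intror Tw) mTw.
    by constructor 3; exists a, b, c, d.
(* The distinct columns [phi l], [psi l] and [chi e1 w] would all go to the two vectors [phi a] and
   [phi b]. *)
- move=> [ab ba fE]; rewrite !fE in f1 f2 f3; exfalso.
  have q1 := col_at_K2 sym2 ab ba c1 f1; have q2 := col_at_K2 sym2 ab ba c2 f2.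
  have q3 := col_at_K2 sym2 ab ba c3 f3.
  have : T (chi e1 w) = T (phi l) \/ T (chi e1 w) = T (phi l + phi w).
    rewrite TD; case: q1 q2 q3 => -> [] E2 [] ->; try by [left]; right; rewrite E2 //.
      by case: Tw0; apply: (@addrI _ (phi a)); rewrite E2 addr0.
    by case: Tw0; apply: (@addrI _ (phi b)); rewrite E2 addr0.
  by case=> /(pi_inj TT') //; apply: chi_support_neq lw.
- move=> [c [ab ac bc fE]]; rewrite !fE in f1 f2.
  case: (quad_diff (col_at_twins sym2 ac bc c1 f1) (col_at_twins sym2 ac bc c2 f2)) => //.
  + by move=> Tw; constructor 2; exists a, b, c.
  + by move=> Tw; have := mult_twins_sum th2 ni2 ab ac bc (or_introl Tw); rewrite leqNgt mTw.
  + by move=> Tw; have := mult_twins_sum th2 ni2 ab ac bc (or_intror Tw); rewrite leqNgt mTw.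
Qed.

(** * Automorphisms of the target matroid *)

Definition transvection (V : finType) (f : vec V -> bool) (t x : vec V) : vec V :=
  x + (if f x then t else 0).

Lemma transvection_add (V : finType) (f : vec V -> bool) (t : vec V) :
  additive_fun f -> additive_fun (transvection f t).
Proof.
move=> fD x y; rewrite /transvection fD; apply/ffunP=> u.
by case: (f x) (f y) => [] []; rewrite !vecE; case: (x u) (y u) (t u) => [] [] [].
Qed.

Lemma transvectionK (V : finType) (f : vec V -> bool) (t : vec V) :
  additive_fun f -> f t = false -> involutive (transvection f t).
Proof.
move=> fD ft x; rewrite /transvection fD.
case: (f x); rewrite ?ft ?(additive_fun0 fD) ?addr0 //.
by rewrite vec_addxK.
Qed.

Definition vec_eqn (V : finType) (x y : vec V) : nat := x == y.

Lemma vec_addC (V : finType) (x y : vec V) : x + y = y + x.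
Proof. exact: addrC. Qed.

Lemma mult_sum (V : finType) (e : rel V) (x : vec V) :
  mult e x =
  (\sum_v (vec_eqn (phi v) x + vec_eqn (chi e v) x + vec_eqn (chi e v + phi v)%R x))%N.
Proof.
rewrite /mult -sum1_card big_mkcond.
rewrite (eq_bigr (fun w : Wg V => vec_eqn (col e (w.1, w.2)) x)); last first.
  by case=> v k _; rewrite inE /vec_eqn; case: (_ == x).
rewrite -(pair_big predT predT (fun v k => vec_eqn (col e (v, k)) x)) /=.
by apply: eq_bigr => v _; rewrite !big_ord_recl big_ord0 /= addn0 addnA.
Qed.

Lemma additive_vecD (V W : finType) (S : vec V -> vec W) :
  additive_fun S -> forall x y : vec V, S (x + y) = S x + S y.
Proof. by []. Qed.

(** The possible exchange of [chi] and [psi] matches [pi_chi], so composing with [S] keeps a pin at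
    [v]. *)
Definition fixes_triple (V : finType) (e : rel V) (S : vec V -> vec V) (v : V) :=
  S (phi v) = phi v /\ (S (chi e v) = chi e v \/ S (chi e v) = chi e v + phi v).

Lemma invol_eqn (V : finType) (S : vec V -> vec V) (x y : vec V) :
  involutive S -> vec_eqn y (S x) = vec_eqn (S y) x.
Proof. by move=> SK; rewrite /vec_eqn -(inj_eq (inv_inj SK)) SK. Qed.

Lemma fixes_triple_sum (V : finType) (e : rel V) (S : vec V -> vec V) (v : V) x :
  additive_fun S -> involutive S -> fixes_triple e S v ->
  (vec_eqn (phi v) (S x) + vec_eqn (chi e v) (S x) + vec_eqn (chi e v + phi v)%R (S x) =
   vec_eqn (phi v) x + vec_eqn (chi e v) x + vec_eqn (chi e v + phi v)%R x)%N.
Proof.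
move=> SD SK [Sphi Schi]; rewrite !(invol_eqn _ _ SK) (additive_vecD SD) Sphi.
by case: Schi => ->; rewrite ?vec_addxK // addnAC.
Qed.

Section ComposeAutomorphism.
Context (V1 V2 : finType) (e1 : rel V1) (e2 : rel V2) (R : V1 -> V2 -> Prop).
Context (T : vec V1 -> vec V2) (T' : vec V2 -> vec V1).
Hypothesis TT' : pinned_iso e1 e2 R T T'.

Lemma pinned_iso_comp (S : vec V2 -> vec V2) :
  additive_fun S -> involutive S -> (forall x, mult e2 (S x) = mult e2 x) ->
  (forall v v', R v v' -> fixes_triple e2 S v') ->
  pinned_iso e1 e2 R (S \o T) (T' \o S).
Proof.
move=> SD SK Sm Sfix; split=> [x y|x|x|x|v v' vv'|v v' vv'] /=.
- by rewrite (pi_add TT') SD.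
- by rewrite SK (pi_K TT').
- by rewrite (pi_K' TT') SK.
- by rewrite Sm (pi_mult TT').
- by rewrite (pi_phi TT' vv'); case: (Sfix _ _ vv').
- have [Sp Sc] := Sfix _ _ vv'.
  case: (pi_chi TT' vv') => ->; rewrite ?SD ?Sp; case: Sc => ->; rewrite ?vec_addxK; tauto.
Qed.

(* Local complementation at the leaf [l]. *)
Lemma leaf_flip (l w : V2) :
  thin e2 -> chi e2 l = phi w -> (forall v, ~ R v l) ->
  let S := transvection (fun x : vec V2 => x l) (phi w) in
  pinned_iso e1 e2 R (S \o T) (T' \o S).
Proof.
move=> [sym irr _ _] lw nR S.
have fD : additive_fun (fun x : vec V2 => x l) by move=> x y; rewrite vecDE.
have lw_neq := leaf_neq irr lw.
have SD : additive_fun S by exact: transvection_add.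
have SK : involutive S by apply: transvectionK => //; rewrite vecE (negPf lw_neq).
have Sfix v : v != l -> fixes_triple e2 S v.
  move=> vl; split; rewrite /S /transvection !vecE.
    by rewrite eq_sym (negPf vl) addr0.
  rewrite sym (leaf_adj v lw); case: eqP => [->|_]; last by left; rewrite addr0.
  by right.
apply: pinned_iso_comp => // [x|v v' vv'].
  rewrite !mult_sum; apply: eq_bigr => v _.
  case: (eqVneq v l) => [->|vl]; last exact: fixes_triple_sum (Sfix _ vl).
  (* On the triple of [l], the map exchanges [phi] and [psi]. *)
  rewrite !(invol_eqn _ _ SK) (additive_vecD SD).
  have -> : S (phi l) = chi e2 l + phi l.
    by rewrite /S /transvection vecE eqxx lw vec_addC.
  have -> : S (chi e2 l) = chi e2 l.
    by rewrite /S /transvection vecE irr addr0.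
  by rewrite addrA vec_addxx add0r addnC addnA addnAC.
by apply: Sfix; apply/eqP => v'l; apply: (nR v); rewrite -v'l.
Qed.

(* Pivot on the pendant edge [l w], which exchanges the roles of [l] and [w]. *)
Lemma leaf_swap (l w : V2) :
  thin e2 -> chi e2 l = phi w -> (forall v, ~ R v l) -> (forall v, ~ R v w) ->
  let S := transvection (fun x : vec V2 => x l) (phi l + chi e2 w) in
  pinned_iso e1 e2 R (S \o T) (T' \o S).
Proof.
move=> [sym irr _ _] lw nRl nRw S.
have fD : additive_fun (fun x : vec V2 => x l) by move=> x y; rewrite vecDE.
have lw_neq := leaf_neq irr lw.
have elw : e2 l w by rewrite sym (leaf_adj w lw).
have SD : additive_fun S by exact: transvection_add.
have SK : involutive S by apply: transvectionK => //; rewrite !vecE eqxx elw.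
have Sfix v : v != l -> v != w -> fixes_triple e2 S v.
  move=> vl vw; split; rewrite /S /transvection !vecE.
    by rewrite eq_sym (negPf vl) addr0.
  by left; rewrite sym (leaf_adj v lw) (negPf vw) addr0.
apply: pinned_iso_comp => // [x|v v' vv'].
  (* [S] exchanges [phi l] with [chi e2 w] and fixes [phi w], which equals [chi e2 l]. Hence the
     triples of [l] and [w] have to be counted together. *)
  rewrite !mult_sum (bigD1 l) // (bigD1 w) 1?eq_sym //=.
  rewrite [in RHS](bigD1 l) // [in RHS](bigD1 w) 1?eq_sym //= !addnA.
  congr (_ + _)%N; last first.
    by apply: eq_bigr => v /andP[vl vw]; apply: fixes_triple_sum (Sfix _ vl vw).
  rewrite !(invol_eqn _ _ SK) !(additive_vecD SD).
  have -> : S (phi l) = chi e2 w.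
    by rewrite /S /transvection vecE eqxx addrA vec_addxx add0r.
  have -> : S (chi e2 w) = phi l.
    by rewrite /S /transvection vecE elw vec_addC vec_addxK.
  have -> : S (phi w) = phi w.
    by rewrite /S /transvection vecE (negPf lw_neq) addr0.
  have -> : S (chi e2 l) = phi w.
    by rewrite /S /transvection vecE irr addr0.
  rewrite lw (vec_addC (phi w) (chi e2 w)) (vec_addC (phi w) (phi l)). lia.
apply: Sfix; apply/eqP => v'E; last by apply: (nRw v); rewrite -v'E.
by apply: (nRl v); rewrite -v'E.
Qed.

(* Unlike the two previous automorphisms, this one does not permute the vertex triples. *)
Lemma path4_swap (a b c d : V2) :
  thin e2 -> chi e2 a = phi b -> chi e2 b = phi a + phi c ->
  chi e2 c = phi b + phi d -> chi e2 d = phi c -> uniq [:: a; b; c; d] ->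
  (forall v v', R v v' -> v' \notin [:: a; b; c; d]) ->
  let S := transvection (fun x : vec V2 => x b (+) x c) (phi b + phi c) in
  pinned_iso e1 e2 R (S \o T) (T' \o S).
Proof.
move=> [sym irr _ _] ab bc cd dc /and5P[]; rewrite !inE !negb_or.
move=> /and3P[nab nac nad] /andP[nbc nbd] ncd _ _ nR S.
have fD : additive_fun (fun x : vec V2 => x b (+) x c).
  by move=> x y; rewrite !vecDE; case: (x b) (x c) (y b) (y c) => [] [] [] [].
have neqs := (negPf nab, negPf nac, negPf nad, negPf nbc, negPf nbd, negPf ncd).
have neqs' : ((b == a) = false) * ((c == a) = false) * ((d == a) = false) *
    ((c == b) = false) * ((d == b) = false) * ((d == c) = false).
  by do !split; rewrite eq_sym neqs.
have SD : additive_fun S by exact: transvection_add.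
have SK : involutive S by apply: transvectionK => //; rewrite !vecE !eqxx neqs neqs'.
have Sfix v : [&& v != a, v != b, v != c & v != d] -> fixes_triple e2 S v.
  case/and4P=> va vb vc vd; split; rewrite /S /transvection !vecE.
    by rewrite !(eq_sym _ v) (negPf vb) (negPf vc) addr0.
  left; rewrite ![e2 _ v]sym.
  have := vec_at v bc; have := vec_at v cd; rewrite !vecE => -> ->.
  by rewrite (negPf va) (negPf vb) (negPf vc) (negPf vd) addr0.
apply: pinned_iso_comp => // [x|v v' vv']; last first.
  by apply: Sfix; have := nR _ _ vv'; rewrite !inE !negb_or.
rewrite !mult_sum.
have split4 (F : V2 -> nat) : (\sum_v F v = F a + (F b + (F c + (F d +
    \sum_(v | [&& v != a, v != b, v != c & v != d]) F v))))%N.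
  rewrite (bigD1 a) // (bigD1 b) ?neqs' // (bigD1 c) ?neqs' // (bigD1 d) ?neqs' //=.
  by do 4 congr (_ + _)%N; apply: eq_bigl => v; rewrite !andbA.
rewrite !split4.
rewrite !addnA; congr (_ + _)%N; last first.
  apply: eq_bigr => v /Sfix; exact: fixes_triple_sum.
(* [S] exchanges the coordinates at [b] and [c]; written in [phi a], ..., [phi d], the twelve
   columns of the path form a multiset invariant under this exchange. *)
rewrite !(invol_eqn _ _ SK) !(additive_vecD SD) ab bc cd dc !(additive_vecD SD).
have -> : S (phi a) = phi a by rewrite /S /transvection !vecE !neqs' addr0.
have -> : S (phi b) = phi c.
  by rewrite /S /transvection !vecE eqxx neqs' addrA vec_addxx add0r.
have -> : S (phi c) = phi b.
  by rewrite /S /transvection !vecE eqxx neqs vec_addC vec_addxK.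
have -> : S (phi d) = phi d by rewrite /S /transvection !vecE !neqs addr0.
have -> : phi a + phi b + phi c = phi a + phi c + phi b by rewrite addrAC.
have -> : phi c + phi d + phi b = phi b + phi d + phi c.
  by rewrite addrAC [phi c + _]vec_addC addrAC.
have -> : phi b + phi a = phi a + phi b by rewrite vec_addC.
have -> : phi c + phi a = phi a + phi c by rewrite vec_addC.
by lia.
Qed.

End ComposeAutomorphism.

(* In the exceptional case, [T' (phi b)] is again the neighbour of a leaf of the first
   forest, and [support_image] for that leaf shows that [b] and [c] span a path component
   [a - b - c - d2], on which [path4_swap] repairs [T]. *)
Lemma support_image_fix (V1 V2 : finType) (e1 : rel V1) (e2 : rel V2) R T T' l w :
  thin e1 -> thin e2 -> no_isolated e1 -> pinned_iso e1 e2 R T T' ->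
  chi e1 l = phi w -> chi e1 w <> phi l ->
  exists T2 T2', pinned_iso e1 e2 R T2 T2' /\
   ((exists a b, [/\ chi e2 a = phi b, forall x, T2' x l = x a & T2 (phi w) = phi b]) \/
    (exists a b c, [/\ a != b, chi e2 a = phi c, chi e2 b = phi c,
       forall x, T2' x l = x a (+) x b & T2 (phi w) = phi c])).
Proof.
move=> th1 th2 ni1 TT' lw nwl; have [sym1 irr1 _ _] := th1; have [sym2 irr2 _ _] := th2.
have ni2 := pi_no_isolated TT' irr1 irr2 ni1.
have TD := pi_add TT'.
have [img|img|] := support_image th1 th2 ni1 TT' lw nwl.
- by exists T, T'; split=> //; left.
- by exists T, T'; split=> //; right.
move=> [a [b [c [d [ab fE bc dc Tw]]]]].
have ac_neq : a != c.
  by apply/eqP => ac; case: (ni2 b); rewrite bc ac vec_addxx.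
have bc_neq : b != c.
  apply/eqP => bc'; have := vec_at b bc; rewrite !vecE irr2 bc' eqxx addbT.
  by rewrite eq_sym (negPf ac_neq).
have Tl x : T x a = x l by rewrite -fE (pi_K TT').
have ncb : chi e2 c <> phi b.
  move=> cb; have := leaf_adj d cb; rewrite sym2 (leaf_adj c dc) eqxx => /esym/eqP db.
  move: bc; rewrite -db dc => /(vec_at a); rewrite !vecE eqxx.
  by rewrite (negPf ac_neq).
have nbrb u : e2 u b -> u = a \/ u = c.
  by move=> ub; have := vec_at u bc; rewrite !vecE ub; do 2 case: eqP; auto.
have leafb u : chi e2 u = phi b -> u = a.
  move=> ub; have : e2 u b by rewrite sym2 (leaf_adj b ub).
  by case/nbrb => // uc; rewrite uc in ub.
(* The images of [phi l] and [chi e1 w] lie among the four columns seen at [a] and differ neither by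
   [0] nor by [phi c], so they differ by [phi b] up to [phi c]. Applying [mult_leaf_sum] in the
   first forest to the repeated column [T' (phi b)] then yields a path [l - w - m - n] with [n] a
   leaf. *)
have [m [n [wm nm Tm]]] : exists m n,
    [/\ chi e1 w = phi l + phi m, chi e1 n = phi m & T (phi m) = phi b].
  have mb : (1 < mult e1 (T' (phi b)))%N.
    by rewrite -(pi_mult TT') (pi_K' TT') (mult_phi_leaf ab).
  have bE : T' (phi b) = phi l + chi e1 w \/ T' (phi b) = phi l + chi e1 w + phi w.
    have img := leaf_image_cols th1 TT' lw.
    have [k1 f1] := img _ (Or41 _ _ _ erefl); rewrite fE in f1.
    have [k3 f3] := img _ (Or43 _ _ _ erefl); rewrite fE in f3.
    have := col_at_leaf sym2 ab k1 f1; have := col_at_leaf sym2 ab k3 f3.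
    rewrite bc => q3 q1.
    have inj x : phi b = T x -> T' (phi b) = x by move=> ->; rewrite (pi_K TT').
    have n1 : T (phi l) <> T (chi e1 w) by move/(pi_inj TT')/esym.
    have n2 : T (phi l) + phi c <> T (chi e1 w).
      by rewrite -Tw -TD => /(pi_inj TT')/esym/(chi_support_neq irr1 lw).
    suff : phi b = T (phi l) + T (chi e1 w) \/
           phi b = T (phi l) + T (chi e1 w) + T (phi w).
      by rewrite -!TD => -[/inj|/inj]; [left|right].
    rewrite Tw; case: q1 q3 n1 n2 => [[]|[]] -> [[]|[]] -> n1 n2;
      do [by case: n1 | case: n2; apply/ffunP=> u; rewrite !vecE;
          by case: (u == a) (u == b) (u == c) => [] [] []
         |left; apply/ffunP=> u; rewrite !vecE;
          by case: (u == a) (u == b) (u == c) => [] [] []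
         |right; apply/ffunP=> u; rewrite !vecE;
          by case: (u == a) (u == b) (u == c) => [] [] []].
  have [m [n [wm nm bm]]] := mult_leaf_sum th1 ni1 lw nwl bE mb.
  by exists m, n; split=> //; rewrite -bm (pi_K' TT').
have mw_neq : m != w.
  apply/eqP => mw; have := vec_at w wm; rewrite mw !vecE irr1 eqxx eq_sym.
  by rewrite (negPf (leaf_neq irr1 lw)).
have lm_neq : l != m.
  by apply/eqP => lm; case: (ni1 w); rewrite wm lm vec_addxx.
have nmn : chi e1 m <> phi n.
  move=> mn; have : e1 w m.
    by rewrite sym1; have := vec_at m wm; rewrite !vecE eqxx eq_sym (negPf lm_neq).
  rewrite (leaf_adj w mn) => /eqP wn; move: wm; rewrite wn nm => /(vec_at l).
  by rewrite !vecE eqxx (negPf lm_neq).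
(* Only the third case survives: the first would make the leaf of [b] serve both [l] and [n], the
   second would give [b] two leaves. *)
have [P4|P4|P4] := support_image th1 th2 ni1 TT' nm nmn.
- have [a2 [b2 [ab2 fE2]]] := P4; rewrite Tm => /phi_inj bb2; rewrite -bb2 in ab2.
  have := fE2 (T (phi l)); rewrite (leafb a2) // -fE (pi_K TT') !vecE eqxx.
  move=> /eqP nl; move: nm; rewrite nl lw => /phi_inj wm'.
  by rewrite wm' eqxx in mw_neq.
- have [a2 [b2 [c2 [ab2 ac2 bc2 _]]]] := P4; rewrite Tm => /phi_inj bc'.
  by move: ab2; rewrite (leafb a2) ?bc' // (leafb b2) ?bc' // eqxx.
have [d2 [b2 [c2 [_ [db2 _ bc2 _]]]]] := P4; rewrite Tm => /phi_inj bc'.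
rewrite -{}bc' in bc2.
have bd2 : b != d2.
  by apply/eqP => bd2; case: (ni2 b2); rewrite bc2 bd2 vec_addxx.
have b2c : b2 = c.
  have : e2 b2 b.
    by rewrite sym2; have := vec_at b bc2; rewrite !vecE eqxx (negPf bd2).
  case/nbrb => // b2a; move: bc2; rewrite b2a ab => /(vec_at d2).
  by rewrite !vecE eqxx eq_sym (negPf bd2).
rewrite {}b2c in bc2 db2.
have ad2 : a != d2.
  apply/eqP => ad2; move: bc_neq; rewrite -(inj_eq (@phi_inj V2)).
  by rewrite -ab -db2 ad2 eqxx.
have cd2 : c != d2 by rewrite eq_sym (leaf_neq irr2 db2).
have ab_neq := leaf_neq irr2 ab.
have uq : uniq [:: a; b; c; d2].
  by rewrite /= !inE !negb_or ab_neq ac_neq ad2 bc_neq bd2 cd2.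
(* A pin on the path would respect a whole triple, contrary to [T (phi w) = phi c],
   [T (phi m) = phi b] and the fact that coordinate [l] becomes coordinate [a]. *)
have nR v v' : R v v' -> v' \notin [:: a; b; c; d2].
  move=> vv'; have Tv := pi_phi TT' vv'; have Tc := pi_chi TT' vv'.
  rewrite !inE !negb_or; apply/and4P; split; apply/eqP => v'E; rewrite {}v'E in Tv Tc.
  - have := Tl (phi v); rewrite Tv !vecE eqxx => /esym/eqP lv.
    move: Tc; rewrite -lv lw Tw ab => -[/phi_inj cb|/(vec_at c)].
      by rewrite cb eqxx in bc_neq.
    by rewrite !vecE eqxx !(eq_sym c) (negPf bc_neq) (negPf ac_neq).
  - have vm : v = m by apply: phi_inj; apply: (pi_inj TT'); rewrite Tv.
    have : T (chi e1 m) a.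
      rewrite -vm; case: Tc => ->; rewrite !vecE ?(negPf ab_neq) ?addbF;
        by rewrite sym2 (leaf_adj b ab) eqxx.
    rewrite Tl !vecE sym1 (leaf_adj m lw); exact/negP.
  - have vw : v = w by apply: phi_inj; apply: (pi_inj TT'); rewrite Tv.
    have : T (chi e1 w) a by rewrite Tl !vecE sym1 (leaf_adj w lw).
    rewrite -vw; case: Tc => ->; rewrite !vecE ?(negPf ac_neq) ?addbF;
      by rewrite sym2 (leaf_adj c ab) eq_sym (negPf bc_neq).
  - have vw : chi e1 v = phi w.
      case: Tc; rewrite db2 -Tw; first by move/(pi_inj TT').
      rewrite -Tv -TD => /(pi_inj TT') vE; have := vec_at v vE.
      rewrite !vecE irr1 eqxx addbT => /esym/negbFE/eqP vw.
      by case: (ni1 v); rewrite vE vw vec_addxx.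
    have : e1 v w by rewrite sym1 (leaf_adj w vw).
    move=> evw; have := vec_at v wm; rewrite !vecE evw.
    case: eqP => [vl _|_ /= /esym/eqP vm].
      have := Tl (phi v); rewrite Tv !vecE vl eqxx.
      by rewrite (negPf ad2).
    by move: bd2; rewrite -(inj_eq (@phi_inj V2)) -Tm -Tv vm eqxx.
have cE : chi e2 c = phi b + phi d2 by rewrite bc2 vec_addC.
have TT2 := path4_swap TT' th2 ab bc cE db2 uq nR.
set S := transvection _ _ in TT2.
exists (S \o T), (T' \o S); split=> //; left; exists a, b; split=> // [x|] /=.
  rewrite fE /S /transvection; case: (_ (+) _); rewrite ?addr0 //.
  by rewrite !vecE (negPf ab_neq) (negPf ac_neq) !addbF.
rewrite Tw /S /transvection !vecE eqxx (negPf bc_neq) /=.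
by rewrite vec_addC vec_addxK.
Qed.

(** * Matching a leaf and its neighbour *)

Lemma K2_of_mult_gt1 (V : finType) (e : rel V) (a b : V) (x : vec V) :
  thin e -> no_isolated e -> chi e a = phi b -> (1 < mult e x)%N -> x a ->
  chi e b = phi a.
Proof.
move=> th ni ab /(mult_gt1_cases th ni); have [sym _ _ _] := th.
case=> [[c [d [dc ->]]]|[s [t [st ts ->]]]].
  rewrite vecE => /eqP ac; rewrite -ac in dc.
  have : e d a by rewrite sym (leaf_adj a dc) eqxx.
  by rewrite (leaf_adj d ab) => /eqP <-.
have aux s' t' : chi e s' = phi t' -> chi e t' = phi s' -> a = s' -> chi e b = phi a.
  by move=> st' ts' as'; rewrite -as' in st' ts'; rewrite -ts'; congr chi; apply: phi_inj;
     rewrite -ab.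
rewrite !vecE; case: (eqVneq a s) => [as_ _|_ /= /eqP at_]; first exact: aux st ts as_.
exact: aux ts st at_.
Qed.

(** The leaf is quantified existentially because on an isolated edge [match_K2] may have to use the
    other end. *)
Definition leaf_matched (V1 V2 : finType) (e1 : rel V1) (e2 : rel V2)
    (R : V1 -> V2 -> Prop) : Prop :=
  exists T T' l w l' w', [/\ pinned_iso e1 e2 R T T',
    chi e1 l = phi w /\ chi e2 l' = phi w', T (phi l) = phi l', T (phi w) = phi w' &
    T (chi e1 w) = chi e2 w' \/ T (chi e1 w) = chi e2 w' + phi w'].

Section LeafMatching.
Context (V1 V2 : finType) (e1 : rel V1) (e2 : rel V2) (R : V1 -> V2 -> Prop).
Hypotheses (th1 : thin e1) (th2 : thin e2) (ni1 : no_isolated e1).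

(** The only defect left is that [phi l] may go to [psi a], which local complementation at [a]
    repairs. Then [a] is not pinned, as its [phi] is the image of [psi l], which is no [phi]. *)
Lemma match_aligned T T' l w a b :
  pinned_iso e1 e2 R T T' -> chi e1 l = phi w -> chi e2 a = phi b ->
  T (phi w) = phi b ->
  T (phi l) = phi a \/ T (phi l) = phi a + phi b ->
  T (chi e1 w) = chi e2 b \/ T (chi e1 w) = chi e2 b + phi b ->
  leaf_matched e1 e2 R.
Proof.
have [sym1 irr1 _ _] := th1; have [sym2 irr2 _ _] := th2.
move=> TT' lw ab Tw [Tl|Tl] Tc; first by exists T, T', l, w, a, b.
have lw_neq := leaf_neq irr1 lw; have ab_neq := leaf_neq irr2 ab.
have nR v : ~ R v a.
  move=> /(pi_phi TT') Tv; have : T (phi v) = T (phi l + phi w).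
    by rewrite (pi_add TT') Tv Tl Tw vec_addxK.
  move/(pi_inj TT') => vE; have := vec_at l vE; have := vec_at w vE.
  rewrite !vecE !eqxx (eq_sym w l) (negPf lw_neq) /= => /eqP wv /eqP lv.
  by rewrite lv wv eqxx in lw_neq.
have TT2 := leaf_flip TT' th2 ab nR.
set S := transvection _ _ in TT2.
exists (S \o T), (T' \o S), l, w, a, b; split=> //=.
- by rewrite Tl /S /transvection !vecE eqxx (negPf ab_neq) vec_addxK.
- by rewrite Tw /S /transvection !vecE (negPf ab_neq) addr0.
- have eab : e2 a b by rewrite sym2 (leaf_adj b ab) eqxx.
  case: Tc => ->; rewrite /S /transvection !vecE eab ?(negPf ab_neq) /=; first by right.
  by left; rewrite vec_addxK.
Qed.

(** Otherwise injectivity would make [chi e1 w] equal to [phi l] or to [psi l]. *)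
Lemma same_pair_absurd T T' l w y p :
  pinned_iso e1 e2 R T T' -> chi e1 l = phi w -> chi e1 w <> phi l ->
  T (phi w) = p -> T (phi l) = y \/ T (phi l) = y + p ->
  T (chi e1 w) = y \/ T (chi e1 w) = y + p -> False.
Proof.
have [sym1 irr1 _ _] := th1.
move=> TT' lw nwl Tw Tl Tc.
have [E|E] : T (chi e1 w) = T (phi l) \/ T (chi e1 w) = T (phi l + phi w).
  rewrite (pi_add TT') Tw; case: Tl => ->; case: Tc => ->; rewrite ?vec_addxK; auto.
by move/(pi_inj TT'): E.
by move/(pi_inj TT'): E; exact: chi_support_neq lw.
Qed.

(** Shows that certain vertices are not pinned: their [phi] is the image of [chi e1 w] or [psi w],
    and neither of these is a [phi]. *)
Lemma phi_chi_support T T' l w v :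
  pinned_iso e1 e2 R T T' -> chi e1 l = phi w -> chi e1 w <> phi l ->
  T (phi v) = T (chi e1 w) \/ T (phi v) = T (chi e1 w + phi w) -> False.
Proof.
have [sym1 irr1 _ _] := th1.
move=> TT' lw nwl.
have elw : e1 l w by rewrite sym1 (leaf_adj w lw) eqxx.
case=> /(pi_inj TT') vE; have := vec_at l vE.
  rewrite !vecE elw => /eqP lv.
  by apply: nwl; rewrite -vE lv.
rewrite !vecE elw (negPf (leaf_neq irr1 lw)) /= => /eqP lv.
have := vec_at w vE; rewrite !vecE irr1 eqxx /= => /eqP wv.
by have := leaf_neq irr1 lw; rewrite lv wv eqxx.
Qed.

Lemma match_leaf T T' l w a b :
  pinned_iso e1 e2 R T T' -> chi e1 l = phi w -> chi e1 w <> phi l ->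
  chi e2 a = phi b -> (forall x, T' x l = x a) -> T (phi w) = phi b ->
  leaf_matched e1 e2 R.
Proof.
have [sym1 irr1 _ _] := th1; have [sym2 irr2 _ _] := th2.
move=> TT' lw nwl ab fE Tw.
have ab_neq := leaf_neq irr2 ab.
have eab : e2 a b by rewrite sym2 (leaf_adj b ab) eqxx.
have img := leaf_image_cols th1 TT' lw.
have [k1 f1] := img _ (Or41 _ _ _ erefl); rewrite fE in f1.
have [k3 f3] := img _ (Or43 _ _ _ erefl); rewrite fE in f3.
have := col_at_leaf sym2 ab k1 f1; have := col_at_leaf sym2 ab k3 f3.
case=> [Tc|Tc] [Tl|Tl].
- by case: (same_pair_absurd TT' lw nwl Tw Tl Tc).
(* The crossed case: [phi l] goes to the triple of [b] and [chi e1 w] to that of [a]. Unless [a b]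
   is an isolated edge, a pivot on it uncrosses them. *)
- case: (eqVneq (chi e2 b) (phi a)) => [ba|/eqP nba].
    by apply: (match_aligned TT' lw ab Tw); rewrite ?ba // -ba.
  have nRa v : ~ R v a.
    move=> /(pi_phi TT') Tv; apply: (phi_chi_support (v := v) TT' lw nwl).
    by case: Tc => Tc; [left|right]; rewrite ?(pi_add TT') Tv Tc ?Tw ?vec_addxK.
  have nRb v : ~ R v b.
    move=> vb; have vw : v = w.
      by apply: phi_inj; apply: (pi_inj TT'); rewrite (pi_phi TT' vb).
    have := pi_chi TT' vb; rewrite vw => Tc'.
    exact: (same_pair_absurd TT' lw nwl Tw Tl Tc').
  have TT2 := leaf_swap TT' th2 ab nRa nRb.
  set S := transvection _ _ in TT2.
  have SD := additive_vecD (transvection_add (phi a + chi e2 b)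
    (fun x y : vec V2 => vecDE x y a)).
  have Sa : S (phi a) = chi e2 b.
    by rewrite /S /transvection vecE eqxx addrA vec_addxx add0r.
  have Sb : S (phi b) = phi b.
    by rewrite /S /transvection vecE (negPf ab_neq) addr0.
  have Sc : S (chi e2 b) = phi a.
    by rewrite /S /transvection vecE eab vec_addC vec_addxK.
  apply: (match_aligned TT2 lw ab) => /=; first by rewrite Tw.
    by case: Tl => ->; rewrite /S ?SD -/S Sc ?Sb; auto.
  by case: Tc => ->; rewrite /S ?SD -/S Sa ?Sb; auto.
- exact: (match_aligned TT' lw ab Tw Tl Tc).
- by case: (same_pair_absurd TT' lw nwl Tw Tl Tc).
Qed.

(** A pivot on the pendant edge [b c] exchanges [phi b] with [chi e2 c] and fixes [phi a];
    afterwards [l] is matched with [a], and [w] with [c]. *)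
Lemma match_twins_aligned T T' l w a b c :
  pinned_iso e1 e2 R T T' -> chi e1 l = phi w -> chi e1 w <> phi l ->
  a != b -> chi e2 a = phi c -> chi e2 b = phi c -> T (phi w) = phi c ->
  T (phi l) = phi a \/ T (phi l) = phi a + phi c ->
  T (chi e1 w) = phi b \/ T (chi e1 w) = phi b + phi c ->
  leaf_matched e1 e2 R.
Proof.
have [sym1 irr1 _ _] := th1; have [sym2 irr2 _ _] := th2.
move=> TT' lw nwl ab ac bc Tw Tl Tc.
have ac_neq := leaf_neq irr2 ac; have bc_neq := leaf_neq irr2 bc.
have eac : e2 a c by rewrite sym2 (leaf_adj c ac) eqxx.
have ebc : e2 b c by rewrite sym2 (leaf_adj c bc) eqxx.
have nRb v : ~ R v b.
  move=> /(pi_phi TT') Tv; apply: (phi_chi_support (v := v) TT' lw nwl).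
  by case: Tc => Tc; [left|right]; rewrite ?(pi_add TT') Tv Tc ?Tw ?vec_addxK.
have nRc v : ~ R v c.
  move=> vc; have vw : v = w.
    by apply: phi_inj; apply: (pi_inj TT'); rewrite (pi_phi TT' vc).
  have : T (chi e1 w) a = false.
    by case: Tc => ->; rewrite !vecE ?(negPf ab) ?(negPf ac_neq).
  by rewrite -vw; case: (pi_chi TT' vc) => ->; rewrite !vecE eac ?(negPf ac_neq).
have TT2 := leaf_swap TT' th2 bc nRb nRc.
set S := transvection _ _ in TT2.
have SD := additive_vecD (transvection_add (phi b + chi e2 c)
  (fun x y : vec V2 => vecDE x y b)).
have Sa : S (phi a) = phi a.
  by rewrite /S /transvection vecE eq_sym (negPf ab) addr0.
have Sb : S (phi b) = chi e2 c.
  by rewrite /S /transvection vecE eqxx addrA vec_addxx add0r.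
have Sc : S (phi c) = phi c.
  by rewrite /S /transvection vecE (negPf bc_neq) addr0.
apply: (match_aligned TT2 lw ac) => /=; first by rewrite Tw.
  by case: Tl => ->; rewrite /S ?SD -/S Sa ?Sc; auto.
by case: Tc => ->; rewrite /S ?SD -/S Sb ?Sc; auto.
Qed.

Lemma match_twins T T' l w a b c :
  pinned_iso e1 e2 R T T' -> chi e1 l = phi w -> chi e1 w <> phi l ->
  a != b -> chi e2 a = phi c -> chi e2 b = phi c ->
  (forall x, T' x l = x a (+) x b) -> T (phi w) = phi c ->
  leaf_matched e1 e2 R.
Proof.
have [sym2 _ _ _] := th2.
move=> TT' lw nwl ab ac bc fE Tw.
have img := leaf_image_cols th1 TT' lw.
have [k1 f1] := img _ (Or41 _ _ _ erefl); rewrite fE in f1.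
have [k3 f3] := img _ (Or43 _ _ _ erefl); rewrite fE in f3.
have := col_at_twins sym2 ac bc k1 f1; have := col_at_twins sym2 ac bc k3 f3.
case=> [Tc|Tc] [Tl|Tl].
- by case: (same_pair_absurd TT' lw nwl Tw Tl Tc).
- by rewrite eq_sym in ab; apply: (match_twins_aligned TT' lw nwl ab bc ac Tw Tl Tc).
- exact: (match_twins_aligned TT' lw nwl ab ac bc Tw Tl Tc).
- by case: (same_pair_absurd TT' lw nwl Tw Tl Tc).
Qed.

(** On an isolated edge [phi l] is repeated too, and a repeated column seen by a leaf forces the
    component of that leaf to be a single edge. *)
Lemma match_K2 T T' l w :
  pinned_iso e1 e2 R T T' -> chi e1 l = phi w -> chi e1 w = phi l ->
  leaf_matched e1 e2 R.
Proof.
have [sym1 irr1 _ _] := th1; have [sym2 irr2 _ _] := th2.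
move=> TT' lw wl; have ni2 := pi_no_isolated TT' irr1 irr2 ni1.
have TD := pi_add TT'.
have img := leaf_image_cols th1 TT' lw.
have [k1 f1] := img _ (Or41 _ _ _ erefl).
have [k2 f2] := img _ (Or42 _ _ _ erefl).
rewrite TD in k2 f2.
have Tw0 : T (phi w) <> 0.
  by rewrite -(additive_fun0 TD) => /(pi_inj TT')/phi_neq0.
have m1 : (1 < mult e2 (T (phi l)))%N by rewrite (pi_mult TT') (mult_phi_leaf wl).
(* Here [phi l] and [psi l] go to [phi a] and [phi b], so [phi w] goes to [phi a + phi b]. The edge
   is matched with [w] as leaf and [l] as neighbour. *)
have sum_match a b : chi e2 a = phi b -> chi e2 b = phi a ->
    (forall x, T' x l = x a (+) x b) -> leaf_matched e1 e2 R.
  move=> ab ba fE; rewrite !fE in f1 f2.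
  have Twl : T (phi w) = T (phi l) + (T (phi l) + T (phi w)).
    by rewrite addrA vec_addxx add0r.
  have := col_at_K2 sym2 ab ba k2 f2; have := col_at_K2 sym2 ab ba k1 f1.
  case=> E1 [] E2; rewrite E2 E1 in Twl.
  - by case: Tw0; rewrite Twl vec_addxx.
  - apply: (match_aligned TT' wl ba E1); first by right; rewrite Twl vec_addC.
    by right; rewrite lw Twl ab vec_addC.
  - apply: (match_aligned TT' wl ab E1); first by right; rewrite Twl vec_addC.
    by right; rewrite lw Twl ba vec_addC.
  - by case: Tw0; rewrite Twl vec_addxx.
have [a [b [[ab fE]|[ab ba fE]|[c [ab ac bc fE]]]]] :=
  leaf_functional_image th1 th2 ni1 TT' lw.
- rewrite !fE in f1 f2.
  have ba := K2_of_mult_gt1 th2 ni2 ab m1 f1.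
  have q1 : T (phi l) = phi a \/ T (phi l) = phi a + phi b.
    by have := col_at_leaf sym2 ab k1 f1; rewrite ba => -[].
  have q2 : T (phi l) + T (phi w) = phi a \/ T (phi l) + T (phi w) = phi a + phi b.
    by have := col_at_leaf sym2 ab k2 f2; rewrite ba => -[].
  apply: (match_aligned TT' lw ab); rewrite ?wl ?ba //.
  case: q1 q2 => -> [] E.
  - by case: Tw0; apply: (@addrI _ (phi a)); rewrite E addr0.
  - exact: addrI E.
  - by apply: (@addrI _ (phi a + phi b)); rewrite E vec_addxK.
  - by case: Tw0; apply: (@addrI _ (phi a + phi b)); rewrite E addr0.
- exact: sum_match ab ba fE.
- rewrite fE in f1; exfalso.
  have [ca|cb] : chi e2 c = phi a \/ chi e2 c = phi b.
    case xa: (T (phi l) a) f1 => /= xb; last by right; apply: K2_of_mult_gt1 bc m1 xb.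
    by left; apply: K2_of_mult_gt1 ac m1 xa.
  - have : e2 b c by rewrite sym2 (leaf_adj c bc) eqxx.
    by rewrite (leaf_adj b ca) eq_sym (negPf ab).
  - have : e2 a c by rewrite sym2 (leaf_adj c ac) eqxx.
    by rewrite (leaf_adj a cb) (negPf ab).
Qed.

Lemma leaf_matching T T' l w :
  pinned_iso e1 e2 R T T' -> chi e1 l = phi w -> leaf_matched e1 e2 R.
Proof.
move=> TT' lw; case: (eqVneq (chi e1 w) (phi l)) => [wl|/eqP nwl].
  exact: match_K2 TT' lw wl.
have [T2 [T2' [TT2 [[a [b [ab fE Tw]]]|[a [b [c [ab ac bc fE Tw]]]]]]]] :=
  support_image_fix th1 th2 ni1 TT' lw nwl.
  exact: match_leaf TT2 lw nwl ab fE Tw.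
exact: match_twins TT2 lw nwl ab ac bc fE Tw.
Qed.

End LeafMatching.

(** * Deleting a vertex and the induction *)

(** The coordinate at [v] sees a single triple, so it becomes the coordinate at some isolated [a];
    the only column nonzero there is [phi a]. *)
Lemma isolated_image (V1 V2 : finType) (e1 : rel V1) (e2 : rel V2) R T T' v :
  symmetric e1 -> symmetric e2 -> irreflexive e2 -> pinned_iso e1 e2 R T T' ->
  chi e1 v = 0 -> exists v', chi e2 v' = 0 /\ T (phi v) = phi v'.
Proof.
move=> sym1 sym2 irr2 TT' v0.
pose f (x : vec V1) := x v; have fD : additive_fun f by move=> x y; rewrite /f vecDE.
have f'D : additive_fun (fun x => f (T' x)) by move=> x y; rewrite (pi_add' TT') fD.
have : #|[pred u | f (phi u) || f (chi e1 u)]| = 1%N.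
  rewrite -(cards1 v); apply: eq_card => u.
  by rewrite !inE /f !vecE sym1 -(chiE e1 v u) v0 vecE orbF eq_sym.
rewrite -(pi_card_support TT' fD) => /mem_card1[a supp].
have fE : forall x, f (T' x) = x a && f (T' (phi a)).
  apply: (functional_single f'D) => u /negPf ua; have := supp u.
  rewrite !inE ua => /negbT/norP[/negPf fu _]; exact: fu.
have fa : f (T' (phi a)).
  apply/negPn/negP => /negPf fa; have := supp a.
  by rewrite !inE eqxx (fE (chi e2 a)) fa andbF.
rewrite fa in fE; exists a.
have a0 : chi e2 a = 0.
  apply/ffunP=> u; rewrite !vecE sym2; case: (eqVneq u a) => [->|ua]; first exact: irr2.
  by have := supp u; rewrite !inE (negPf ua) (fE (chi _ _)) !vecE andbT => /negbT/norP[_ /negPf].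
split=> //; have Ta : T (phi v) a.
  by have := fE (T (phi v)); rewrite /f (pi_K TT') vecE eqxx andbT.
have [u uE] : is_col e2 (T (phi v)).
  by apply: (pi_is_col TT'); exists v; constructor 1.
have eau : e2 a u = false by rewrite sym2 -chiE a0 vecE.
move: Ta; case: uE => ->; rewrite !vecE ?eau // => /eqP <- //.
by rewrite a0 add0r.
Qed.

Definition del_rel (V : finType) (e : rel V) (l : V) : rel {v : V | v != l} :=
  fun x y => e (val x) (val y).

Definition triple_count (V : finType) (e : rel V) (v : V) (x : vec V) : nat :=
  (vec_eqn (phi v) x + vec_eqn (chi e v) x + vec_eqn (chi e v + phi v)%R x)%N.

Section Deletion.
Context (V : finType) (e : rel V) (l : V).
Local Notation U := {v : V | v != l}.

(** This is the quotient by [phi l], so on columns it performs the contraction of that element;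
    [ext] is a section of it. *)
Definition res (x : vec V) : vec U := [ffun u => x (val u)].
Definition ext (z : vec U) : vec V :=
  [ffun v => if insub v is Some u then z u else false].

Lemma res_add : additive_fun res.
Proof. by move=> x y; apply/ffunP=> u; rewrite !(ffunE, vecDE). Qed.

Lemma ext_val z (u : U) : ext z (val u) = z u.
Proof. by rewrite ffunE valK. Qed.

Lemma ext_l z : ext z l = false.
Proof. by rewrite ffunE insubF // eqxx. Qed.

Lemma ext_add : additive_fun ext.
Proof.
move=> x y; apply/ffunP=> u; rewrite vecDE; rewrite !ffunE.
by case: insub => // v; rewrite vecDE.
Qed.

Lemma extK : cancel ext res.
Proof. by move=> z; apply/ffunP=> u; rewrite ffunE ext_val. Qed.

Lemma resK x : ext (res x) = x + (if x l then phi l else 0).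
Proof.
apply/ffunP=> u; rewrite vecDE; case: (eqVneq u l) => [->|ul].
  by rewrite ext_l; case: (x l); rewrite !vecE ?eqxx.
have uE : u = val (Sub u ul : U) by rewrite SubK.
rewrite {1}uE ext_val ffunE SubK; case: (x l); rewrite !vecE ?(negPf ul) addbF //.
Qed.

Lemma res_phi (u : U) : res (phi (val u)) = phi u.
Proof. by apply/ffunP=> u'; rewrite ffunE !vecE. Qed.

Lemma res_phi_l : res (phi l) = 0.
Proof. by apply/ffunP=> u; rewrite ffunE !vecE (negPf (valP u)). Qed.

Lemma res_chi (u : U) : res (chi e (val u)) = chi (del_rel e (l := l)) u.
Proof. by apply/ffunP=> u'; rewrite ffunE !vecE. Qed.

Lemma res_eqn x z : vec_eqn (res x) z = (vec_eqn x (ext z) + vec_eqn x (ext z + phi l)%R)%N.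
Proof.
rewrite /vec_eqn; case: (eqVneq (res x) z) => [<-|neq].
  rewrite resK; case: (x l); rewrite ?vec_addxK ?addr0 eqxx.
    rewrite -{1}[x]addr0 (inj_eq (addrI x)) eq_sym.
    by case: eqP => // /phi_neq0.
  rewrite -{1}[x]addr0 (inj_eq (addrI x)) eq_sym.
  by case: eqP => // /phi_neq0.
case: eqP => [xE|_]; first by rewrite xE extK eqxx in neq.
case: eqP => [xE|_] //.
by rewrite xE (res_add (ext z)) extK res_phi_l addr0 eqxx in neq.
Qed.

Lemma sum_del (F : V -> nat) : (\sum_(v | v != l) F v = \sum_(u : U) F (val u))%N.
Proof.
rewrite (reindex_omap (val : U -> V) insub) => [|v vl]; last by rewrite insubT.
by apply: eq_bigl => u; rewrite valK eqxx (valP u).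
Qed.

Lemma mult_split x :
  mult e x = (triple_count e l x + \sum_(v | v != l) triple_count e v x)%N.
Proof. by rewrite mult_sum (bigD1 l). Qed.

(** The lifts of [z] are [ext z] and [ext z + phi l]. The columns over [z] in the deleted graph are
    those equal to either lift, except the ones in the triple of [l]. *)
Lemma mult_del z :
  (mult (del_rel e (l := l)) z + triple_count e l (ext z) + triple_count e l (ext z + phi l)%R =
   mult e (ext z) + mult e (ext z + phi l)%R)%N.
Proof.
suff E : mult (del_rel e (l := l)) z =
    (\sum_(v | v != l) triple_count e v (ext z) +
     \sum_(v | v != l) triple_count e v (ext z + phi l)%R)%N.
  by rewrite E !mult_split; lia.
rewrite mult_sum -big_split sum_del; apply: eq_bigr => u _.
have psiE : chi (del_rel e (l := l)) u + phi u = res (chi e (val u) + phi (val u)).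
  by rewrite -res_phi -res_chi -res_add.
by rewrite psiE -res_phi -res_chi !res_eqn /triple_count /=; lia.
Qed.

Lemma ext_phi (u : U) : ext (phi u) = phi (val u).
Proof. by rewrite -res_phi resK vecE eq_sym (negPf (valP u)) addr0. Qed.

Lemma ext_chi (u : U) :
  ext (chi (del_rel e (l := l)) u) = chi e (val u) + (if e l (val u) then phi l else 0).
Proof. by rewrite -res_chi resK vecE. Qed.

Lemma val_cases v : v = l \/ exists u : U, v = val u.
Proof.
case: (eqVneq v l) => [|vl]; first by left.
by right; exists (Sub v vl); rewrite SubK.
Qed.

Lemma forest_del : forest e -> forest (del_rel e (l := l)).
Proof.
move=> [[sym irr] acyc]; split; first by split=> [x y|x]; rewrite /del_rel ?irr.
move=> c size_c uniq_c.
have -> : cycle (del_rel e (l := l)) c = cycle e (map val c) by rewrite cycle_map.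
by apply: acyc; rewrite ?size_map ?(map_inj_uniq val_inj).
Qed.

End Deletion.

Section DeletionIso.
Context (V1 V2 : finType) (e1 : rel V1) (e2 : rel V2) (R : V1 -> V2 -> Prop).
Context (T : vec V1 -> vec V2) (T' : vec V2 -> vec V1) (l : V1) (l' : V2).
Local Notation U1 := {v : V1 | v != l}.
Local Notation U2 := {v : V2 | v != l'}.

Lemma triple_count_iso x : pinned_iso e1 e2 R T T' ->
  T (phi l) = phi l' -> T (chi e1 l) = chi e2 l' ->
  triple_count e2 l' (T x) = triple_count e1 l x.
Proof.
move=> TT' Tl Tc; rewrite /triple_count /vec_eqn -Tl -Tc -(pi_add TT').
by rewrite !(inj_eq (pi_inj TT')).
Qed.

(** As [phi l] goes to [phi l'], [T] descends to the quotients. As the whole triple is matched, the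
    corrections in [mult_del] agree on both sides. *)
Lemma pinned_iso_del : pinned_iso e1 e2 R T T' ->
  T (phi l) = phi l' -> T (chi e1 l) = chi e2 l' ->
  pinned_iso (del_rel e1 (l := l)) (del_rel e2 (l := l'))
    (fun u u' => R (val u) (val u'))
    (fun z => res l' (T (ext z))) (fun z => res l (T' (ext z))).
Proof.
move=> TT' Tl Tc; have TD := additive_vecD (pi_add TT').
have T'D := additive_vecD (pi_add' TT').
have T0 := additive_fun0 TD; have T'0 := additive_fun0 T'D.
have T'l : T' (phi l') = phi l by rewrite -Tl (pi_K TT').
split=> [x y|z|z|z|u u' uu'|u u' uu'].
- by rewrite ext_add TD res_add.
- rewrite resK T'D (pi_K TT'); case: ifP => _; rewrite ?T'l ?T'0 ?addr0 ?extK //.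
  by rewrite res_add extK res_phi_l addr0.
- rewrite resK TD (pi_K' TT'); case: ifP => _; rewrite ?Tl ?T0 ?addr0 ?extK //.
  by rewrite res_add extK res_phi_l addr0.
- have := mult_del e2 (res l' (T (ext z))); have := mult_del e1 z.
  rewrite -!(triple_count_iso _ TT' Tl Tc) -!(pi_mult TT') TD Tl.
  rewrite resK; case: ifP => _; rewrite ?addr0 ?vec_addxK; lia.
- by rewrite ext_phi (pi_phi TT' uu') res_phi.
- have -> : res l' (T (ext (chi (del_rel e1 (l := l)) u))) = res l' (T (chi e1 (val u))).
    rewrite ext_chi TD res_add; case: ifP => _; rewrite ?Tl ?T0 ?res_phi_l ?addr0 //.
    by rewrite (additive_fun0 (@res_add _ l')) addr0.
  case: (pi_chi TT' uu') => ->; first by left; rewrite res_chi.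
  by right; rewrite res_add res_chi res_phi.
Qed.

Lemma graph_iso_extend (f : U1 -> U2) :
  symmetric e1 -> symmetric e2 -> irreflexive e1 -> irreflexive e2 ->
  bijective f -> (forall x y, e2 (val (f x)) (val (f y)) = e1 (val x) (val y)) ->
  (forall u, e2 (val (f u)) l' = e1 (val u) l) ->
  exists h : V1 -> V2, [/\ bijective h, forall x y, e2 (h x) (h y) = e1 x y,
    h l = l' & forall u, h (val u) = val (f u)].
Proof.
move=> sym1 sym2 irr1 irr2 [g fK gK] fe fl.
pose h v := if insub v is Some u then val (f u) else l'.
pose k v := if insub v is Some u then val (g u) else l.
have hl : h l = l' by rewrite /h insubF // eqxx.
have kl : k l' = l by rewrite /k insubF // eqxx.
have hu u : h (val u) = val (f u) by rewrite /h valK.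
have ku u : k (val u) = val (g u) by rewrite /k valK.
exists h; split=> //.
  exists k => v.
    by case: (val_cases l v) => [->|[u ->]]; rewrite ?hl ?hu ?ku ?fK.
  by case: (val_cases l' v) => [->|[u ->]]; rewrite ?kl ?ku ?hu ?gK.
move=> x y; case: (val_cases l x) (val_cases l y) => [->|[u ->]] [->|[u' ->]].
- by rewrite irr2 irr1.
- by rewrite hl hu sym2 fl sym1.
- by rewrite hl hu fl.
- by rewrite !hu fe.
Qed.

End DeletionIso.

Lemma add_pin (V1 V2 : finType) (e1 : rel V1) (e2 : rel V2) R T T' w w' :
  pinned_iso e1 e2 R T T' -> T (phi w) = phi w' ->
  T (chi e1 w) = chi e2 w' \/ T (chi e1 w) = chi e2 w' + phi w' ->
  pinned_iso e1 e2 (fun v v' => R v v' \/ v = w /\ v' = w') T T'.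
Proof.
move=> TT' Tw Tc; split; try by case: TT'.
  by move=> v v' [/(pi_phi TT')|[-> ->]].
by move=> v v' [/(pi_chi TT')|[-> ->]].
Qed.

(** The last clause strengthens the induction: it tells where the neighbour of a deleted leaf
    goes. *)
Lemma pinned_iso_graph_iso n (V1 V2 : finType) (e1 : rel V1) (e2 : rel V2) R T T' :
  #|V1| = n -> forest e1 -> forest e2 -> pinned_iso e1 e2 R T T' ->
  exists f : V1 -> V2, [/\ bijective f, forall x y, e2 (f x) (f y) = e1 x y &
    forall v v', R v v' -> f v = v'].
Proof.
elim: n V1 V2 e1 e2 R T T' => [|n IH] V1 V2 e1 e2 R T T' cV F1 F2 TT'.
  have no1 (v : V1) : False by have := fintype0 v; rewrite cV.
  have no2 (v : V2) : False.
    apply: (phi_neq0 (v := v)); rewrite -[phi v](pi_K' TT').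
    rewrite -(additive_fun0 (pi_add TT')); congr T.
    by apply/ffunP=> u; case: (no1 u).
  exists (fun v => False_rect V2 (no1 v)); split=> [|x|x]; try by case: (no1 x).
  by exists (fun v => False_rect V1 (no2 v)) => v; [case: (no1 v)|case: (no2 v)].
have th1 := forest_thin F1; have th2 := forest_thin F2.
have [sym1 irr1 _ _] := th1; have [sym2 irr2 _ _] := th2.
have step R2 T2 T2' l l' : pinned_iso e1 e2 R2 T2 T2' ->
    (forall v v', R v v' -> R2 v v') ->
    T2 (phi l) = phi l' -> T2 (chi e1 l) = chi e2 l' ->
    (forall f : {v : V1 | v != l} -> {v : V2 | v != l'}, bijective f ->
       (forall u u', R2 (val u) (val u') -> f u = u') ->
       forall u, e2 (val (f u)) l' = e1 (val u) l) ->
    exists f : V1 -> V2, [/\ bijective f, forall x y, e2 (f x) (f y) = e1 x y &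
      forall v v', R v v' -> f v = v'].
  move=> TT2 RR2 Tl Tc adj.
  have cU : #|{: {v : V1 | v != l}}| = n by rewrite card_sig cardC1 cV.
  have [f [bf fe fR]] := IH _ _ _ _ _ _ _ cU (forest_del l F1) (forest_del l' F2)
    (pinned_iso_del TT2 Tl Tc).
  have [h [bh he hl hu]] := graph_iso_extend sym1 sym2 irr1 irr2 bf fe (adj f bf fR).
  exists h; split=> // v v' /RR2 vv'; have Tv := pi_phi TT2 vv'.
  case: (val_cases l v) => [vl|[u vu]]; rewrite ?vl ?vu ?hl ?hu.
    by apply: phi_inj; rewrite -Tl -Tv vl.
  case: (val_cases l' v') => [vl'|[u' vu']].
    have vl : v = l by apply: phi_inj; apply: (pi_inj TT2); rewrite Tv vl' Tl.
    by have := valP u; rewrite -vu vl eqxx.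
  by rewrite vu' (fR u u') // -vu -vu'.
case: (pickP (fun v => chi e1 v == 0)) => [v /eqP v0|ni].
  have [v' [v'0 Tv]] := isolated_image sym1 sym2 irr2 TT' v0.
  apply: (step R T T' v v') => // [|f _ _ u].
    by rewrite v0 v'0 (additive_fun0 (pi_add TT')).
  by rewrite -!(chiE _ _ (val _)) v0 v'0 !vecE.
have ni1 : no_isolated e1 by move=> v /eqP; rewrite ni.
have [v0 _] : exists v0 : V1, v0 \in V1 by apply/card_gt0P; rewrite cV.
have [v dv] := acyclic_deg_le1 v0 F1; have [u uv] := no_isolatedP v ni1.
have vu : chi e1 v = phi u.
  apply/ffunP=> x; rewrite !vecE; apply/idP/eqP => [xv|->//].
  by apply: dv; rewrite sym1.
have [T2 [T2' [l [w [l' [w' [TT2 [lw lw'] Tl Tw Tc]]]]]]] := leaf_matching th1 th2 ni1 TT' vu.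
(* With [w] pinned to [w'], the smaller isomorphism maps the unique neighbour of [l] to that of
   [l'], so the leaves can be reattached. *)
apply: (step _ _ _ l l' (add_pin TT2 Tw Tc)) => // [x x'|| f bf fR x].
- by left.
- by rewrite lw lw' Tw.
have wl : w != l by rewrite eq_sym (leaf_neq irr1 lw).
have wl' : w' != l' by rewrite eq_sym (leaf_neq irr2 lw').
have fw : f (Sub w wl) = Sub w' wl' by apply: fR; right; rewrite !SubK.
rewrite (leaf_adj _ lw) (leaf_adj _ lw'); apply/eqP/eqP => xw.
  have fx : f x = f (Sub w wl) by rewrite fw; apply: val_inj; rewrite /= xw.
  by rewrite (bij_inj bf fx) SubK.
have -> : x = Sub w wl by apply: val_inj; rewrite /= xw.
by rewrite fw SubK.
Qed.

(** * From matroid isomorphisms to linear maps *)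

(** The sets with this property form the cycle space of the binary matroid. *)
Definition zero_sum (V : finType) (e : rel V) (C : {set Wg V}) : bool :=
  \sum_(w in C) col e w == 0.

Lemma natr_F2_add (a b : bool) : (a (+) b)%:R = a%:R + b%:R :> 'F_2.
Proof. by case: a b => [] []; apply/val_inj. Qed.

Lemma natr_F2_eq0 (a : bool) : a%:R = 0 :> 'F_2 -> a = false.
Proof. by case: a => // /eqP. Qed.

Lemma F2_natr (x : 'F_2) : x = (x != 0)%:R.
Proof. by case: x => [[|[|k]] lt_k] //; apply: val_inj. Qed.

Lemma IAS_colE (V : finType) (e : rel V) (w : Wg V) (u : V) :
  IAS_col e w u = (col e w u)%:R.
Proof.
case: w => v [[|[|k]] lt_k] /=; rewrite /adjF2 ?vecE //.
by rewrite natr_F2_add.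
Qed.

Lemma IAS_sumE (V : finType) (e : rel V) (c : Wg V -> 'F_2) (u : V) :
  \sum_w c w * IAS_col e w u = ((\sum_(w in [set w | c w != 0%R]) col e w)%R u)%:R.
Proof.
rewrite sum_ffunE (big_morph _ natr_F2_add (erefl : false%:R = 0 :> 'F_2)).
rewrite [RHS]big_mkcond /=; apply: eq_bigr => w _; rewrite inE IAS_colE.
by rewrite {1}[c w]F2_natr; case: (c w != 0); rewrite ?mul1r ?mul0r.
Qed.

Lemma iso_indepP (V : finType) (e : rel V) (S : {set Wg V}) :
  reflect (iso_indep e S)
    [forall C : {set Wg V}, (C \subset S) ==> zero_sum e C ==> (C == set0)].
Proof.
apply: (iffP forallP) => [ind c cS c0 w|ind C].
  have := ind [set w | c w != 0].
  have -> : [set w | c w != 0] \subset S.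
    by apply/subsetP => w'; rewrite inE; apply: contraNT => /cS ->.
  have -> : zero_sum e [set w | c w != 0].
    by apply/eqP/ffunP=> u; rewrite vec0E; apply: natr_F2_eq0; rewrite -IAS_sumE c0.
  by move=> /= /eqP/setP/(_ w); rewrite !inE => /negbFE/eqP.
apply/implyP=> /subsetP CS; apply/implyP=> /eqP C0.
pose c w : 'F_2 := (w \in C)%:R.
have cC : [set w | c w != 0] = C.
  by apply/setP=> w; rewrite inE /c; case: (w \in C).
apply/eqP/setP=> w; rewrite inE; apply: natr_F2_eq0; apply: (ind c) => [w' w'S|u].
  by rewrite /c; case: (boolP (w' \in C)) => // /CS; rewrite (negPf w'S).
by rewrite IAS_sumE cC C0 vec0E.
Qed.

Lemma zero_sumD (V : finType) (e : rel V) (C D : {set Wg V}) :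
  D \subset C -> zero_sum e D -> zero_sum e C = zero_sum e (C :\: D).
Proof.
move=> DC /eqP D0; rewrite /zero_sum (big_setID D) /=.
by rewrite (setIidPr DC) D0 add0r.
Qed.

Lemma dependent_subset (V : finType) (e : rel V) (C : {set Wg V}) :
  ~ iso_indep e C -> exists D : {set Wg V}, [/\ D \subset C, zero_sum e D & D != set0].
Proof.
move=> /iso_indepP; rewrite negb_forall => /existsP[D].
by rewrite !negb_imply => /and3P[]; exists D.
Qed.

Lemma zero_sum_dependent (V : finType) (e : rel V) (C : {set Wg V}) :
  C != set0 -> zero_sum e C -> ~ iso_indep e C.
Proof.
move=> C0 zC /iso_indepP/forallP/(_ C).
by rewrite subxx zC (negPf C0).
Qed.

Section MatroidIso.
Context (V1 V2 : finType) (e1 : rel V1) (e2 : rel V2) (g : Wg V1 -> Wg V2).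
Context (h : Wg V2 -> Wg V1).
Hypotheses (gK : cancel g h) (hK : cancel h g).

Lemma imset_preim (D : {set Wg V2}) : g @: (h @: D) = D.
Proof. by rewrite -imset_comp (eq_imset D hK) imset_id. Qed.

Lemma zero_sum_indep :
  (forall C : {set Wg V1}, zero_sum e2 (g @: C) = zero_sum e1 C) ->
  forall S : {set Wg V1}, iso_indep e1 S <-> iso_indep e2 (g @: S).
Proof.
move=> zs S; split=> /iso_indepP/forallP ind; apply/iso_indepP/forallP=> C;
  apply/implyP=> CS; apply/implyP=> C0.
  have hCS : h @: C \subset S.
    by have := imsetS h CS; rewrite -imset_comp (eq_imset S gK) imset_id.
  by have := ind (h @: C); rewrite hCS -zs imset_preim C0 imset_eq0.
have := ind (g @: C); rewrite zs C0 (imsetS g CS) /= => /eqP gC0.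
by rewrite -(imset_eq0 g) gC0.
Qed.

Hypothesis indep : forall S : {set Wg V1}, iso_indep e1 S <-> iso_indep e2 (g @: S).

(* Cycles of a binary matroid are disjoint unions of circuits, hence determined by the
   independent sets. *)
Lemma indep_zero_sum (C : {set Wg V1}) : zero_sum e2 (g @: C) = zero_sum e1 C.
Proof.
have [n] := ubnP #|C|; elim: n C => // n IH C /ltnSE le_C.
case: (eqVneq C set0) => [->|C0].
  by rewrite imset0 /zero_sum !big_set0 !eqxx.
(* A nonempty zero-sum proper subset [D] reduces the claim for [C] to the smaller sets [D] and
   [C :\: D]. *)
have split_on (D : {set Wg V1}) : D \subset C -> D != set0 -> D != C ->
    zero_sum e2 (g @: D) = zero_sum e1 D /\
    zero_sum e2 (g @: C :\: g @: D) = zero_sum e1 (C :\: D).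
  move=> DC D0 neDC; split.
    apply: IH; apply: leq_trans le_C; apply: proper_card.
    by rewrite properEneq neDC.
  have -> : g @: C :\: g @: D = g @: (C :\: D).
    by rewrite !(can2_imset_pre _ gK hK) preimsetD.
  apply: IH; apply: leq_trans le_C; apply: proper_card.
  rewrite properE subsetDl; apply/negP => /subsetP sC.
  have [x xD] := set0Pn _ D0; have := sC x (subsetP DC x xD).
  by rewrite inE xD.
apply/idP/idP => zC.
  have gC0 : g @: C != set0 by rewrite imset_eq0.
  have /dependent_subset[D [DC zD D0]] : ~ iso_indep e1 C.
    by move/indep; apply: zero_sum_dependent.
  case: (eqVneq D C) zD => [->//|neDC] zD.
  have [zgD zgCD] := split_on D DC D0 neDC; rewrite zD in zgD.
  by rewrite (zero_sumD DC zD) -zgCD -(zero_sumD (imsetS g DC) zgD).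
have /dependent_subset[D' [DC' zD' D0']] : ~ iso_indep e2 (g @: C).
  by move/indep; apply: zero_sum_dependent.
pose D := h @: D'; have gD : g @: D = D' by exact: imset_preim.
have DC : D \subset C.
  by have := imsetS h DC'; rewrite -imset_comp (eq_imset C gK) imset_id.
have D0 : D != set0 by rewrite imset_eq0.
case: (eqVneq D C) => [DE|neDC]; first by rewrite -DE gD.
have [zgD zgCD] := split_on D DC D0 neDC; rewrite gD zD' in zgD.
rewrite (zero_sumD (imsetS g DC)) ?gD // -gD zgCD -(zero_sumD DC) //.
Qed.

Definition basis_map (x : vec V1) : vec V2 :=
  \sum_u (if x u then col e2 (g (u, ord0)) else 0).

Lemma basis_map_add : additive_fun basis_map.
Proof.
move=> x y; rewrite /basis_map -big_split; apply: eq_bigr => u _ /=.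
rewrite vecDE; case: (x u) (y u) => [] [] /=; rewrite ?addr0 ?add0r //.
by rewrite vec_addxx.
Qed.

Lemma basis_map_phi u : basis_map (phi u) = col e2 (g (u, ord0)).
Proof.
rewrite /basis_map (bigD1 u) //= big1 ?addr0 => [|v vu]; rewrite vecE.
  by rewrite eqxx.
by rewrite (negPf vu).
Qed.

(** A column outside the [phi] basis, together with the [phi u] for [u] in its support, sums to zero
    (its fundamental circuit). As [g] preserves zero sums, the expansion carries over to the
    images. *)
Lemma basis_map_col w : basis_map (col e1 w) = col e2 (g w).
Proof.
case: w => v k; case: (eqVneq k ord0) => [->|k0]; first exact: basis_map_phi.
set w := (v, k); pose P := [set (u, ord0 : 'I_3) | u in [set u | col e1 w u]].
have inj0 : {in [set u | col e1 w u] &, injective (fun u => (u, ord0 : 'I_3))}.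
  by move=> u u' _ _ [].
have wP : w \notin P by apply/imsetP => -[u _ [_ /eqP]]; rewrite (negPf k0).
have z1 : zero_sum e1 (w |: P).
  rewrite /zero_sum big_setU1 //= big_imset //= big_set.
  by rewrite [X in _ + X]big_mkcond -vec_sum vec_addxx.
have := z1; rewrite -indep_zero_sum /zero_sum big_imset; last first.
  by move=> x y _ _; apply: (can_inj gK).
rewrite big_setU1 //= big_imset //= big_set [X in _ + X]big_mkcond => /eqP E.
by apply: (@addrI _ (col e2 (g w))); rewrite vec_addxx.
Qed.

End MatroidIso.

Lemma matroid_iso_pinned (V1 V2 : finType) (e1 : rel V1) (e2 : rel V2) :
  isotropic_matroid_iso e1 e2 ->
  exists T T', pinned_iso e1 e2 (fun _ _ => False) T T'.
Proof.
move=> [g [[h gK hK] indep]].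
have indep' (S : {set Wg V2}) : iso_indep e2 S <-> iso_indep e1 (h @: S).
  by rewrite (indep (h @: S)) (imset_preim hK).
pose T := basis_map e2 g; pose T' := basis_map e1 h.
have TD : additive_fun T := basis_map_add e2 g.
have T'D : additive_fun T' := basis_map_add e1 h.
have TE := basis_map_col gK hK indep; have T'E := basis_map_col hK gK indep'.
have TK : cancel T T'.
  apply: (@additive_eq _ _ (fun x => T' (T x)) id) => // [x y|v].
    by rewrite TD T'D.
  by rewrite /T basis_map_phi /T' T'E gK.
have T'K : cancel T' T.
  apply: (@additive_eq _ _ (fun x => T (T' x)) id) => // [x y|v].
    by rewrite T'D TD.
  by rewrite /T' basis_map_phi /T TE hK.
exists T, T'; split=> // x; rewrite /mult -!sum1_card (reindex g); last first.
  by exists h => w _; [apply: gK|apply: hK].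
apply: eq_bigl => w; rewrite !inE -TE; exact: (inj_eq (can_inj TK)).
Qed.

(** * Graph isomorphisms induce matroid isomorphisms *)

Lemma graph_iso_matroid_iso (V1 V2 : finType) (e1 : rel V1) (e2 : rel V2) :
  graph_iso e1 e2 -> isotropic_matroid_iso e1 e2.
Proof.
move=> [f [[f' fK f'K] fe]].
pose g (w : Wg V1) : Wg V2 := (f w.1, w.2); pose h (w : Wg V2) : Wg V1 := (f' w.1, w.2).
have gK : cancel g h by case=> v k; rewrite /g /h /= fK.
have hK : cancel h g by case=> v k; rewrite /g /h /= f'K.
exists g; split; first by exists h.
apply: (zero_sum_indep gK hK) => C; rewrite /zero_sum big_imset; last first.
  by move=> x y _ _; apply: (can_inj gK).
have colE w u : col e2 (g w) (f u) = col e1 w u.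
  by case: w => v [[|[|k]] lt_k]; rewrite /= !vecE ?fe ?(inj_eq (can_inj fK)).
have sumE u : (\sum_(w in C) col e2 (g w)) (f u) = (\sum_(w in C) col e1 w) u.
  by rewrite !sum_ffunE; apply: eq_bigr => w _; apply: colE.
apply/eqP/eqP => /ffunP E; apply/ffunP=> u.
  by rewrite -sumE E !vecE.
by rewrite -[u]f'K sumE E !vecE.
Qed.

Theorem mainTheorem1 (V1 V2 : finType) (e1 : rel V1) (e2 : rel V2) :
  forest e1 -> forest e2 ->
  (graph_iso e1 e2 <-> isotropic_matroid_iso e1 e2).
Proof.
move=> F1 F2; split; first exact: graph_iso_matroid_iso.
move=> /matroid_iso_pinned[T [T' TT']].
have [f [bf fe _]] := pinned_iso_graph_iso erefl F1 F2 TT'.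
by exists f.
Qed.
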